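(* Let $b,c$ be positive integers. The greedy basis $\{x[a_1,a_2]:(a_1,a_2)\in\mathbb{Z}^2\}$ of $\mathcal{A}(b,c)$ is invariant under the action of all the automorphisms $\sigma_p$ ($p\in\mathbb{Z}$). Specifically, $\sigma_1$ and $\sigma_2$ act on greedy elements by $$\sigma_1(x[a_1,a_2])=x[a_1,\,c[a_1]_+-a_2],\qquad \sigma_2(x[a_1,a_2])=x[b[a_2]_+-a_1,\,a_2]$$ for all $(a_1,a_2)\in\mathbb{Z}^2$, where $[a]_+=\max(a,0)$.
   Context: Cluster algebra. Let $\mathcal{F}=\mathbb{Q}(x_1,x_2)$ and define $x_m\in\mathcal{F}$ for all $m\in\mathbb{Z}$ by $x_{m-1}x_{m+1}=x_m^b+1$ for $m$ odd and $x_{m-1}x_{m+1}=x_m^c+1$ for $m$ even. $\mathcal{A}=\mathcal{A}(b,c)$ is the subring of $\mathcal{F}$ generated by all $x_m$. For $p\in\mathbb{Z}$, $\sigma_p$ is the involutive automorphism of $\mathcal{A}$ acting on cluster variables by $\sigma_p(x_m)=x_{2p-m}$ for all $m\in\mathbb{Z}$. Greedy elements. Conventions: $\binom{a}{k}=0$ unless $0\le k\le a$; an empty sum is $0$. An element $x\in\mathcal{A}$ is pointed at $(a_1,a_2)\in\mathbb{Z}^2$ if $x=x_1^{-a_1}x_2^{-a_2}\sum_{p,q\ge0}c(p,q)x_1^{bp}x_2^{cq}$ with $c(p,q)\in\mathbb{Z}$ (finitely many nonzero) and $c(0,0)=1$. It is greedy at $(a_1,a_2)$ if moreover $$c(p,q)=\max\left(\sum_{k=1}^p(-1)^{k-1}c(p-k,q)\binom{a_2-cq+k-1}{k},\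 \sum_{k=1}^q(-1)^{k-1}c(p,q-k)\binom{a_1-bp+k-1}{k}\right)$$ for every nonzero $(p,q)\in\mathbb{Z}_{\ge0}^2$. For each $(a_1,a_2)\in\mathbb{Z}^2$ there is a unique greedy element, denoted $x[a_1,a_2]$; the family of all of them is called the greedy basis. *)

(* Defs.v *)
From HB Require Import structures.
From mathcomp Require Import all_boot all_order all_algebra fraction mpoly.
From mathcomp Require Import boolp classical_sets.
From mathcomp Require Import zify ring.

Set Implicit Arguments.
Unset Strict Implicit.
Unset Printing Implicit Defensive.

Import Order.TTheory GRing.Theory Num.Theory.

Local Open Scope ring_scope.

(* The field Q(x_1, x_2). *)
Notation ambient := {fraction {mpoly rat[2]}}.

Notation ofpoly := (@FracField.tofrac {mpoly rat[2]}).

Definition var1 : ambient := ofpoly 'X_ord0.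
Definition var2 : ambient := ofpoly 'X_ord_max.

Section ClusterVariables.
Variables b c : nat.

Definition clexp (m : int) : nat := if odd `|m|%N then b else c.

(* clfwd n = (x_(n+1), x_(n+2)) and clbwd n = (x_(1-n), x_(2-n)) *)
Fixpoint clfwd (n : nat) : ambient * ambient :=
  if n is n'.+1 then
    let: (u, v) := clfwd n' in (v, (v ^+ clexp n'.+2%:Z + 1) / u)
  else (var1, var2).

Fixpoint clbwd (n : nat) : ambient * ambient :=
  if n is n'.+1 then
    let: (u, v) := clbwd n' in ((u ^+ clexp (1 - n'%:Z) + 1) / v, u)
  else (var1, var2).

Definition clvar (m : int) : ambient :=
  match m - 1 with
  | Posz n => (clfwd n).1
  | Negz n => (clbwd n.+1).1
  end.

Lemma clvar_fwd (n : nat) : clfwd n = (clvar n.+1%:Z, clvar n.+2%:Z).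
Proof.
have H k : clvar k.+1%:Z = (clfwd k).1.
  by rewrite /clvar (_ : k.+1%:Z - 1 = Posz k) //; lia.
rewrite !H /=; case: (clfwd n) => u v //.
Qed.

Lemma clvar_bwd (n : nat) : clbwd n = (clvar (1 - n%:Z), clvar (2 - n%:Z)).
Proof.
have H k : clvar (1 - k%:Z) = (clbwd k).1.
  rewrite /clvar; case: k => [|k]; first by rewrite subrr.
  by rewrite (_ : 1 - k.+1%:Z - 1 = Negz k) //; lia.
case: n => [|n].
  by rewrite H /= /clvar (_ : 2 - 0%:Z - 1 = Posz 1) //; lia.
rewrite (_ : 2 - n.+1%:Z = 1 - n%:Z); last by lia.
by rewrite !H /=; case: (clbwd n) => u v.
Qed.

Lemma clvar1 : clvar 1 = var1. Proof. by []. Qed.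
Lemma clvar2 : clvar 2 = var2. Proof. by []. Qed.

(* Fractions whose numerator and denominator are positive at (1, 1). *)
Let val1 (p : {mpoly rat[2]}) : rat := meval (fun=> 1) p.
Let posfrac (f : ambient) := exists p q,
  [/\ 0 < val1 p, 0 < val1 q & f = ofpoly p / ofpoly q].

Let ofpoly_neq0 p : 0 < val1 p -> ofpoly p != 0.
Proof.
move=> p0; rewrite tofrac_eq0; apply/eqP => p_eq0.
by move: p0; rewrite p_eq0 /val1 meval0 ltxx.
Qed.

Let posfrac_neq0 f : posfrac f -> f != 0.
Proof.
by move=> [p [q [hp hq ->]]]; rewrite mulf_neq0 ?invr_neq0 ?ofpoly_neq0.
Qed.

Let posfrac1 : posfrac 1.
Proof. by exists 1, 1; rewrite /val1 meval1 rmorph1 divr1; split. Qed.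

Let posfracD f g : posfrac f -> posfrac g -> posfrac (f + g).
Proof.
move=> [p [q [hp hq ->]]] [p' [q' [hp' hq' ->]]].
exists (p * q' + p' * q), (q * q'); rewrite /val1 mevalD !mevalM.
split; [by rewrite addr_gt0 ?mulr_gt0 | by rewrite mulr_gt0 |].
by rewrite !(rmorphD, rmorphM) /= addf_div ?ofpoly_neq0.
Qed.

Let posfracM f g : posfrac f -> posfrac g -> posfrac (f * g).
Proof.
move=> [p [q [hp hq ->]]] [p' [q' [hp' hq' ->]]].
exists (p * p'), (q * q'); rewrite /val1 !mevalM.
by split; rewrite ?mulr_gt0 // !rmorphM /= mulf_div.
Qed.

Let posfracV f : posfrac f -> posfrac f^-1.
Proof. by move=> [p [q [hp hq ->]]]; exists q, p; split; rewrite ?invf_div. Qed.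

Let posfracX f n : posfrac f -> posfrac (f ^+ n).
Proof.
by move=> pf; elim: n => [|n IH]; rewrite ?expr0 // exprS; apply: posfracM.
Qed.

Let posfrac_var i : posfrac (ofpoly 'X_i).
Proof.
by exists 'X_i, 1; rewrite /val1 meval1 mevalXU rmorph1 divr1; split.
Qed.

Let posfrac_step u v n : posfrac u -> posfrac v -> posfrac ((u ^+ n + 1) / v).
Proof.
by move=> pu pv; apply/posfracM/posfracV => //; apply/posfracD => //;
  apply: posfracX.
Qed.

Lemma clvar_neq0 m : clvar m != 0.
Proof.
have fwd n : posfrac (clfwd n).1 /\ posfrac (clfwd n).2.
  elim: n => [|n] /=; first by split; apply: posfrac_var.
  by case: (clfwd n) => u v /= [pu pv]; split=> //; apply: posfrac_step.
have bwd n : posfrac (clbwd n).1 /\ posfrac (clbwd n).2.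
  elim: n => [|n] /=; first by split; apply: posfrac_var.
  by case: (clbwd n) => u v /= [pu pv]; split=> //; apply: posfrac_step.
apply: posfrac_neq0; rewrite /clvar; case: (m - 1) => n.
  by case: (fwd n).
by case: (bwd n.+1).
Qed.

Lemma clvar_rec m : clvar (m - 1) * clvar (m + 1) = clvar m ^+ clexp m + 1.
Proof.
have [m_ge2|m_lt2] := lerP 2 m.
  have [n ->] : exists n : nat, m = n.+2%:Z by exists `|m - 2|%N; lia.
  have := clvar_fwd n.+1; rewrite /= clvar_fwd => -[] E.
  rewrite (_ : n.+2%:Z - 1 = n.+1%:Z); last by lia.
  rewrite (_ : n.+2%:Z + 1 = n.+3%:Z) -?E; last by lia.
  by rewrite mulrC divfK ?clvar_neq0.
have [n ->] : exists n : nat, m = 1 - n%:Z by exists `|1 - m|%N; lia.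
have := clvar_bwd n.+1; rewrite /= clvar_bwd => -[] E _.
rewrite (_ : 1 - n%:Z - 1 = 1 - n.+1%:Z) -?E; last by lia.
rewrite (_ : 1 - n%:Z + 1 = 2 - n%:Z); last by lia.
by rewrite divfK ?clvar_neq0.
Qed.

End ClusterVariables.

Section ClusterAlgebra.
Variables b c : nat.

(* Membership in the smallest subring containing all the cluster variables. *)
Definition in_clalg : {pred ambient} := fun f =>
  `[< forall S : {pred ambient}, subring_closed S ->
      (forall m, clvar b c m \in S) -> f \in S >].

Lemma in_clalgP f : reflect (forall S : {pred ambient}, subring_closed S ->
  (forall m, clvar b c m \in S) -> f \in S) (f \in in_clalg).
Proof. exact: asboolP. Qed.

Lemma clvar_in_clalg m : clvar b c m \in in_clalg.
Proof. by apply/in_clalgP => S _; apply. Qed.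

Lemma in_clalg_subring : subring_closed in_clalg.
Proof.
split.
- by apply/in_clalgP => S [].
- move=> f g /in_clalgP fA /in_clalgP gA; apply/in_clalgP => S SS xS.
  by have [_ SB _] := SS; apply: SB; [apply: fA | apply: gA].
- move=> f g /in_clalgP fA /in_clalgP gA; apply/in_clalgP => S SS xS.
  by have [_ _ SM] := SS; apply: SM; [apply: fA | apply: gA].
Qed.

HB.instance Definition _ := GRing.isSubringClosed.Build ambient in_clalg
  in_clalg_subring.

Record clalg := ClAlg { clalg_val : ambient; _ : clalg_val \in in_clalg }.

HB.instance Definition _ := [isSub for clalg_val].
HB.instance Definition _ := [Choice of clalg by <:].
HB.instance Definition _ := [SubChoice_isSubComNzRing of clalg by <:].

Definition clelt (m : int) : clalg := ClAlg (clvar_in_clalg m).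

End ClusterAlgebra.

Section FieldLift.

Lemma frac_numden (f : ambient) : f = ofpoly \n_(repr f) / ofpoly \d_(repr f).
Proof.
have d0 : ofpoly \d_(repr f) != 0 by rewrite tofrac_eq0 denom_ratioP.
apply: (mulIf d0); rewrite divfK //.
rewrite -{1}[f]reprK; unlock FracField.tofrac.
rewrite -[LHS]FracField.pi_mul; apply/eqmodP => /=.
rewrite FracField.equivfE /FracField.mulf !numden_Ratio ?oner_neq0 ?mulr1
  ?denom_ratioP //.
by rewrite mulrC.
Qed.

Lemma fracP (f : ambient) : exists p q : {mpoly rat[2]}, q != 0 /\ f = ofpoly p / ofpoly q.
Proof.
exists \n_(repr f), \d_(repr f); split; first exact: denom_ratioP.
exact: frac_numden.
Qed.

Variable phi : {rmorphism {mpoly rat[2]} -> ambient}.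
Hypothesis phi_inj : forall p, phi p = 0 -> p = 0.

Let phi_neq0 p : p != 0 -> phi p != 0.
Proof. by apply: contraNneq => /phi_inj ->. Qed.

Let lift (f : ambient) := phi \n_(repr f) / phi \d_(repr f).

Let liftE (p q : {mpoly rat[2]}) : q != 0 -> lift (ofpoly p / ofpoly q) = phi p / phi q.
Proof.
move=> q0; rewrite /lift; set f := ofpoly p / _.
have d0 := denom_ratioP (repr f).
have Ef := frac_numden f.
apply/eqP; rewrite eqr_div ?phi_neq0 // -!rmorphM.
move/eqP: Ef; rewrite {1}/f eqr_div ?tofrac_eq0 // -!rmorphM tofrac_eq.
by move=> /eqP ->.
Qed.

Lemma frac_lift :
  exists s : {rmorphism ambient -> ambient}, forall p, s (ofpoly p) = phi p.
Proof.
have lift_zmod : zmod_morphism lift.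
  move=> f g; have [p [q [q0 ->]]] := fracP f; have [p' [q' [q'0 ->]]] := fracP g.
  rewrite -mulNr addf_div ?tofrac_eq0 // -rmorphN -!rmorphM -rmorphD.
  rewrite !liftE ?mulf_neq0 // -mulNr addf_div ?phi_neq0 //.
  by rewrite !(rmorphD, rmorphM, rmorphN).
have lift_mon : monoid_morphism lift.
  split; first by rewrite -[1]divr1 -(tofrac1 _) liftE ?oner_neq0 // rmorph1 divr1.
  move=> f g; have [p [q [q0 ->]]] := fracP f; have [p' [q' [q'0 ->]]] := fracP g.
  rewrite mulf_div -!rmorphM !liftE ?mulf_neq0 // mulf_div.
  by rewrite !rmorphM.
pose zm := GRing.isZmodMorphism.Build _ _ lift lift_zmod.
pose mm := GRing.isMonoidMorphism.Build _ _ lift lift_mon.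
pose s : {rmorphism ambient -> ambient} := HB.pack lift zm mm.
by exists s => p; rewrite /= -[ofpoly p]divr1 -(tofrac1 _) liftE ?oner_neq0 //
  rmorph1 divr1.
Qed.

End FieldLift.

Section Reflections.
Variables b c : nat.

(* The substitution 'X_j |-> ('X_i ^+ e + 1) / 'X_j is injective, as it is an
   involution once 'X_j is inverted. *)
Lemma frac_reflection (i j : 'I_2) (e : nat) (w : ambient) :
    i != j -> w != 0 -> w * ofpoly 'X_j = ofpoly 'X_i ^+ e + 1 ->
  exists s : {rmorphism ambient -> ambient},
    s (ofpoly 'X_i) = ofpoly 'X_i /\ s (ofpoly 'X_j) = w.
Proof.
move=> ij w0 wE.
pose h k := if k == j then w else ofpoly 'X_k.
pose cst : {rmorphism rat -> ambient} := GRing.RMorphism.clone _ _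
  (ofpoly \o @mpolyC 2 rat) _.
pose phi : {rmorphism {mpoly rat[2]} -> ambient} := GRing.RMorphism.clone _ _
  (mmap cst h) _.
have phiX k : phi 'X_k = h k by rewrite /phi /= mmapX mmap1U.
pose Xj : ambient := ofpoly 'X_j.
pose Q r := exists s N, phi r * Xj ^+ N = ofpoly s /\ phi s = ofpoly r * w ^+ N.
have phi_Xj : phi 'X_j = w by rewrite phiX /h eqxx.
have phi_Xi : phi 'X_i = ofpoly 'X_i by rewrite phiX /h (negPf ij).
have QM r r' : Q r -> Q r' -> Q (r * r').
  move=> [s [N [H1 H2]]] [s' [N' [H1' H2']]]; exists (s * s'), (N + N')%N.
  by rewrite !rmorphM /= -H1 -H1' H2 H2' !exprD; split; ring.
have QD r r' : Q r -> Q r' -> Q (r + r').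
  move=> [s [N [H1 H2]]] [s' [N' [H1' H2']]].
  exists (s * 'X_j ^+ N' + s' * 'X_j ^+ N), (N + N')%N.
  rewrite !(rmorphM, rmorphD, rmorphXn) /= -H1 -H1' H2 H2' phi_Xj !exprD.
  by rewrite -/Xj; split; ring.
have QC a : Q a%:MP.
  by exists a%:MP, 0%N; rewrite !expr0 !mulr1 /phi /= mmapC.
have QX k : Q 'X_k.
  have [->|kj] := eqVneq k j.
    exists ('X_i ^+ e + 1), 1%N.
    rewrite !(rmorphD, rmorphXn, rmorph1) /= !expr1 phi_Xj phi_Xi.
    by rewrite -wE; split; rewrite // mulrC.
  by exists 'X_k, 0%N; rewrite !expr0 !mulr1 phiX /h (negPf kj).
have QXn r n : Q r -> Q (r ^+ n).
  move=> Qr; elim: n => [|n IH]; last by rewrite exprS; apply: QM.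
  by rewrite expr0 -mpolyC1; apply: QC.
have Qall r : Q r.
  elim/mpolyind: r => [|a m p _ _ Qp]; first by rewrite -mpolyC0; apply: QC.
  apply: (QD) => //; rewrite -mul_mpolyC; apply: (QM) => //.
  rewrite mpolyXE_id big_ord_recl big_ord1.
  by apply: (QM); apply: (QXn).
have phi_inj p : phi p = 0 -> p = 0.
  move=> p0; have [s [N [H1 H2]]] := Qall p.
  move: H1; rewrite p0 mul0r => /esym/eqP; rewrite tofrac_eq0 => /eqP s0.
  move: H2; rewrite s0 rmorph0 => /esym/eqP.
  by rewrite mulf_eq0 expf_eq0 (negPf w0) andbF orbF tofrac_eq0 => /eqP.
have [s sE] := frac_lift phi_inj.
by exists s; rewrite !sE.
Qed.

Local Notation x := (clvar b c).

Lemma clexp_reflect (p m : int) : clexp b c (2 * p - m) = clexp b c m.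
Proof. by rewrite /clexp (_ : odd `|(2 * p - m)%R|%N = odd `|m|%N) //; lia. Qed.

Lemma clvar_reflect (p k : int) (s : {rmorphism ambient -> ambient}) :
    s (x k) = x (2 * p - k) -> s (x (k + 1)) = x (2 * p - (k + 1)) ->
  forall m, s (x m) = x (2 * p - m).
Proof.
move=> sk sk1.
have up n : s (x (k + n%:Z)) = x (2 * p - (k + n%:Z)) /\
            s (x (k + n%:Z + 1)) = x (2 * p - (k + n%:Z + 1)).
  elim: n => [|n [IH1 IH2]]; first by rewrite addr0.
  rewrite (_ : k + n.+1%:Z = k + n%:Z + 1); last by lia.
  split=> //; set m := k + n%:Z + 1.
  have H := clvar_rec b c m; have H' := clvar_rec b c (2 * p - m).
  apply: (@mulfI _ (s (x (m - 1)))); first by rewrite fmorph_eq0 clvar_neq0.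
  rewrite -rmorphM H rmorphD rmorphXn rmorph1 IH2.
  rewrite -[in LHS](clexp_reflect p) -H' mulrC.
  rewrite (_ : m - 1 = k + n%:Z) ?IH1; last by rewrite /m; lia.
  by congr (x _ * x _); rewrite /m; lia.
have dn n : s (x (k - n%:Z)) = x (2 * p - (k - n%:Z)) /\
            s (x (k - n%:Z + 1)) = x (2 * p - (k - n%:Z + 1)).
  elim: n => [|n [IH1 IH2]]; first by rewrite subr0.
  rewrite (_ : k - n.+1%:Z + 1 = k - n%:Z); last by lia.
  split=> //; set m := k - n%:Z.
  have H := clvar_rec b c m; have H' := clvar_rec b c (2 * p - m).
  rewrite (_ : k - n.+1%:Z = m - 1); last by rewrite /m; lia.
  apply: (@mulIf _ (s (x (m + 1)))); first by rewrite fmorph_eq0 clvar_neq0.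
  rewrite -rmorphM H rmorphD rmorphXn rmorph1 IH1.
  rewrite -[in LHS](clexp_reflect p) -H' mulrC IH2.
  by congr (x _ * x _); lia.
move=> m; have [km|mk] := lerP k m.
  by rewrite (_ : m = k + `|m - k|%N%:Z); [case: (up `|m - k|%N) | lia].
by rewrite (_ : m = k - `|k - m|%N%:Z); [case: (dn `|k - m|%N) | lia].
Qed.

Lemma field_reflection (p : int) :
  exists s : {rmorphism ambient -> ambient}, forall m, s (x m) = x (2 * p - m).
Proof.
have [s1 s1E] : exists s : {rmorphism ambient -> ambient},
    forall m, s (x m) = x (2 * 1 - m).
  have [s [H1 H2]] := @frac_reflection ord0 ord_max b (x 0) isT
    (clvar_neq0 b c 0) (clvar_rec b c 1).
  by exists s; apply: (@clvar_reflect 1 1).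
have [s2 s2E] : exists s : {rmorphism ambient -> ambient},
    forall m, s (x m) = x (2 * 2 - m).
  have E : x 3 * x 1 = x 2 ^+ c + 1 by rewrite mulrC; have := clvar_rec b c 2.
  have [s [H1 H2]] := @frac_reflection ord_max ord0 c (x 3) isT
    (clvar_neq0 b c 3) E.
  by exists s; apply: (@clvar_reflect 2 1).
have up n : exists s : {rmorphism ambient -> ambient},
    forall m, s (x m) = x (2 * (1 + n%:Z) - m).
  elim: n => [|n [s sE]]; first by exists s1.
  exists (s2 \o (s1 \o s)) => m /=; rewrite sE s1E s2E; congr x; lia.
have dn n : exists s : {rmorphism ambient -> ambient},
    forall m, s (x m) = x (2 * (1 - n%:Z) - m).
  elim: n => [|n [s sE]]; first by exists s1.
  exists (s1 \o (s2 \o s)) => m /=; rewrite sE s2E s1E; congr x; lia.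
have [p1|p1] := lerP 1 p.
  by rewrite (_ : p = 1 + `|p - 1|%N%:Z); [apply: up | lia].
by rewrite (_ : p = 1 - `|1 - p|%N%:Z); [apply: dn | lia].
Qed.

Lemma clalg_reflection (p : int) :
  exists s : {rmorphism clalg b c -> clalg b c},
    involutive s /\ forall m, s (clelt b c m) = clelt b c (2 * p - m).
Proof.
have [s sE] := field_reflection p.
have sA f : f \in in_clalg b c -> s f \in in_clalg b c.
  move=> /in_clalgP /(_ [pred f | s f \in in_clalg b c]); apply.
    have [A1 AB AM] := in_clalg_subring b c.
    split=> [|u v uA vA|u v uA vA]; rewrite -topredE /=.
    - by rewrite rmorph1; apply: A1.
    - by rewrite rmorphB; apply: AB.
    - by rewrite rmorphM; apply: AM.
  by move=> m; rewrite -topredE /= sE clvar_in_clalg.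
pose t (f : clalg b c) : clalg b c := ClAlg (sA _ (valP f)).
have t_zmod : zmod_morphism t.
  by move=> f g; apply: val_inj; rewrite /= !rmorphB.
have t_mon : monoid_morphism t.
  split; first by apply: val_inj; rewrite /= !rmorph1.
  by move=> f g; apply: val_inj; rewrite /= !rmorphM.
pose zm := GRing.isZmodMorphism.Build _ _ t t_zmod.
pose mm := GRing.isMonoidMorphism.Build _ _ t t_mon.
pose u : {rmorphism clalg b c -> clalg b c} := HB.pack t zm mm.
exists u; split=> [f|m]; apply: val_inj => /=; last exact: sE.
have /in_clalgP /(_ [pred f | s (s f) == f]) := valP f.
move=> H; apply/eqP; apply: H.
  split=> [|g h|g h]; rewrite !inE ?rmorph1 ?rmorphB ?rmorphM //=.
    by move=> /eqP -> /eqP ->.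
  by move=> /eqP -> /eqP ->.
by move=> m; rewrite inE !sE (_ : 2 * p - (2 * p - m) = m) //; lia.
Qed.

Definition sigma (p : int) : {rmorphism clalg b c -> clalg b c} :=
  projT1 (cid (clalg_reflection p)).

Lemma sigmaK p : involutive (sigma p).
Proof. by rewrite /sigma; case: cid => s []. Qed.

Lemma sigma_clelt p m : sigma p (clelt b c m) = clelt b c (2 * p - m).
Proof. by rewrite /sigma; case: cid => s []. Qed.

End Reflections.

Section Greedy.
Variables b c : nat.

(* For a < 0 the convention differs from the usual extension of the binomial
   coefficient to negative upper arguments. *)
Definition binz (a : int) (k : nat) : int :=
  if 0 <= a then 'C(`|a|, k)%N%:Z else 0.

Definition posz_part (a : int) : int := Num.max a 0.

Definition pointed_expansion (a1 a2 : int) (co : nat -> nat -> int)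
    (x : ambient) : Prop :=
  co 0 0 = 1 /\
  exists2 N : nat,
    (forall p q, co p q != 0 -> (p < N)%N /\ (q < N)%N) &
    x = var1 ^ (- a1) * var2 ^ (- a2) *
        \sum_(p < N) \sum_(q < N)
          (co p q)%:~R * var1 ^+ (b * p) * var2 ^+ (c * q).

Definition greedy_recurrence (a1 a2 : int) (co : nat -> nat -> int) : Prop :=
  forall p q : nat, (p, q) <> (0, 0)%N ->
    co p q = Num.max
      (\sum_(1 <= k < p.+1) (-1) ^+ k.-1 * co (p - k)%N q *
         binz (a2 - (c * q)%:Z + k%:Z - 1) k)
      (\sum_(1 <= k < q.+1) (-1) ^+ k.-1 * co p (q - k)%N *
         binz (a1 - (b * p)%:Z + k%:Z - 1) k).

Definition is_greedy (a1 a2 : int) (x : clalg b c) : Prop :=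
  exists2 co : nat -> nat -> int,
    pointed_expansion a1 a2 co (clalg_val x) & greedy_recurrence a1 a2 co.

Lemma greedy_coeffs_uniq a1 a2 co co' :
    co 0 0 = co' 0 0 -> greedy_recurrence a1 a2 co ->
  greedy_recurrence a1 a2 co' -> forall p q, co p q = co' p q.
Proof.
move=> co0 co_rec co'_rec p q.
have [n] := ubnP (p + q)%N; elim: n p q => // n IH p q pq.
have [[-> -> //]|pq0] := pselect ((p, q) = (0, 0)%N).
rewrite co_rec // co'_rec //; congr Num.max; rewrite !big_nat;
  apply: eq_bigr => k k_bnd; congr (_ * _ * _); apply: IH; lia.
Qed.

Lemma pointed_expansion_uniq a1 a2 co co' x y : (forall p q, co p q = co' p q) ->
  pointed_expansion a1 a2 co x -> pointed_expansion a1 a2 co' y -> x = y.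
Proof.
move=> coE [_ [N Nsup ->]] [_ [N' N'sup ->]]; congr (_ * _).
pose F p q : ambient := (co p q)%:~R * var1 ^+ (b * p) * var2 ^+ (c * q).
transitivity (\sum_(p < N') \sum_(q < N') F p q); last first.
  by apply: eq_bigr => p _; apply: eq_bigr => q _; rewrite /F coE.
have wide n m : (n <= m)%N ->
    (forall p q, co p q != 0 -> (p < n)%N /\ (q < n)%N) ->
    \sum_(p < n) \sum_(q < n) F p q = \sum_(p < m) \sum_(q < m) F p q.
  move=> nm sup; rewrite [RHS](bigID (fun p : 'I_m => p < n)%N) /=.
  rewrite [X in _ + X]big1 ?addr0 => [|p /negP pn]; last first.
    apply: big1 => q _; rewrite /F.
    by have [->|/sup[]//] := eqVneq (co p q) 0; rewrite !mul0r.
  rewrite (big_ord_widen m (fun p => \sum_(q < n) F p q) nm).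
  apply: eq_bigr => p _; rewrite (big_ord_widen m (F p) nm) big_mkcond.
  apply: eq_bigr => q _; case: ifPn => // /negP qn; rewrite /F.
  by have [->|/sup[]//] := eqVneq (co p q) 0; rewrite !mul0r.
have N'sup' p q : co p q != 0 -> (p < N')%N /\ (q < N')%N.
  by rewrite coE; apply: N'sup.
have [NN'|/ltnW N'N] := leqP N N'; first exact: wide.
by rewrite -(wide _ _ N'N).
Qed.

Lemma is_greedy_uniq a1 a2 (x y : clalg b c) :
  is_greedy a1 a2 x -> is_greedy a1 a2 y -> x = y.
Proof.
move=> [co ex rx] [co' ey ry]; apply: val_inj.
apply: (pointed_expansion_uniq (greedy_coeffs_uniq _ rx ry) ex ey).
by rewrite ex.1 ey.1.
Qed.

(* The element x[a1, a2], unique by is_greedy_uniq. A theorem of Lee, Li and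
   Zelevinsky provides one for each (a1, a2) when b, c > 0, so the default 0 is
   then never taken. *)
Definition greedy (a1 a2 : int) : clalg b c :=
  xget 0 [set x | is_greedy a1 a2 x]%classic.

Definition greedy_basis : set (clalg b c) :=
  range (fun a : int * int => greedy a.1 a.2).

End Greedy.

Arguments greedy : clear implicits.
Arguments greedy_basis : clear implicits.

(* Main.v *)
From HB Require Import structures.
Require Import Defs.
From mathcomp Require Import boolp classical_sets.
From mathcomp Require Import all_boot all_order all_algebra fraction mpoly.
From mathcomp Require Import zify ring.

Set Implicit Arguments.
Unset Strict Implicit.
Unset Printing Implicit Defensive.

Import Order.TTheory GRing.Theory Num.Theory.
Local Open Scope ring_scope.

(** Why the statement holds.

    Write x = x_1^(-a1) x_2^(-a2) sum_(p,q) c(p,q) t^p s^q with t = x_1^b and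
    s = x_2^c.  For fixed q let d(p,q) be the coefficients, in p, of the row
    polynomial sum_p c(p,q) t^p divided by (1+t)^[a2-cq]_+, and for fixed p let
    e(p,q) be the coefficients, in q, of the column polynomial divided by
    (1+s)^[a1-bp]_+.  The two sums in the greedy recurrence are c - d and c - e,
    so x is greedy exactly when min(d, e) = 0 away from the origin
    ([greedy_recurrenceE]).

    The automorphism sigma_1 replaces x_2 by (1+t)/x_2.  On the table d it only
    reverses the order of the rows, q |-> [a1]_+ - q ([row_form_reflect]), so
    the point is that the reversed table d' is again greedy for
    (a1, c[a1]_+ - a2): the new column quotients e' must be nonnegative and
    disjoint from d'.  The sign of e' is not a formal consequence of the
    hypotheses on d and e; it comes from a combinatorial model.

    For a1, a2 > 0 the model counts the compatible pairs (S1, S2) of sets of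
    horizontal and vertical edges on the maximal Dyck path with a1 horizontal
    and a2 vertical edges (Lee, Li and Zelevinsky).  An edge of S1 outside the
    shadow of S2 can be added or removed freely and the shadow has b|S2| edges,
    so the column polynomials are (1+s)^(a1-bp) times polynomials with
    nonnegative coefficients ([pair_count_core]).  A telescoping sum of heights
    over the shadow gives a slope condition ([core_slope]): off the origin
      e(p,q) <> 0 implies a1 c q < a2 b p,
    and by the symmetry of the path d(p,q) <> 0 implies a2 b p < a1 c q.  Hence
    d and e are nonnegative with disjoint supports and the model is greedy
    ([path_slope_greedy]).

    The two slope conditions alone determine all the coefficients
    ([slope_rule_uniq]), because at each point one of d and e vanishes.  Unlike
    positivity, they can be carried through the reflection by an argument on
    degrees ([flip_slope_rule]): in terms of q, passing from c to the reflected
    coefficients of column p is a combination of differential operators of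
    order j applied to the columns p - j, so the factor (1+s)^(a1-bp) survives and bounds the
    support of e'.  The reflected table therefore coincides with the model at
    (a1, c a1 - a2), which is greedy.  This needs c a1 - a2 > 0; as a2 and
    c a1 - a2 have a positive sum, one of them is positive, and the reflection
    is an involution ([greedy_rows_reflect]).

    The case of sigma_2 follows by exchanging the variables, and every sigma_p
    is a product of copies of sigma_1 and sigma_2.  Since greedy elements are
    carried to greedy elements in both directions, x[a1,a2] and its reflection
    exist together, and the default value 0 is respected as well
    ([greedy_transport]). *)

(** * Multiplying and dividing a sequence by powers of 1 + t *)

Section Deconvolution.
Variable R : comNzRingType.
Implicit Types u v : nat -> R.

Definition shift_add u (p : nat) : R := u p + (if p is p'.+1 then u p' else 0).
Definition binom_conv (n : nat) u : nat -> R := iter n shift_add u.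
(** Division by (1 + t)^n, written with the nonnegative binomial
    coefficients as they occur in the greedy recurrence. *)
Definition binom_deconv (n : nat) u (p : nat) : R :=
  \sum_(k < p.+1) (-1) ^+ k * u (p - k)%N *+ 'C((n + k).-1, k).

Lemma binom_deconv0 u : binom_deconv 0 u = u.
Proof.
apply: funext => p; rewrite /binom_deconv big_ord_recl /= bin0 subn0 expr0 mul1r mulr1n.
by rewrite big1 ?addr0 // => k _; rewrite bin_small ?mulr0n // /bump; lia.
Qed.

Lemma binom_deconv_head n u : binom_deconv n u 0 = u 0.
Proof. by rewrite /binom_deconv big_ord1 /= bin0 expr0 mul1r mulr1n. Qed.

Lemma shift_add_deconv n u : shift_add (binom_deconv n.+1 u) = binom_deconv n u.
Proof.
apply: funext => -[|p] /=; rewrite /shift_add ?binom_deconv_head ?addr0 //.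
rewrite /binom_deconv big_ord_recl [RHS]big_ord_recl /= !bin0 -addrA; congr (_ + _).
rewrite -big_split /=; apply: eq_bigr => k _; rewrite /bump /= add1n subSS.
by rewrite addnS binS mulrnDr exprS mulN1r !mulNr !mulNrn addrNK.
Qed.

Lemma shift_add_inj : injective shift_add.
Proof.
move=> u v uv; apply: funext => p.
elim: p => [|p IH]; first by have := congr1 (@^~ 0%N) uv; rewrite /shift_add !addr0.
by have := congr1 (@^~ p.+1) uv; rewrite /shift_add IH => /addIr.
Qed.

Lemma binom_conv_inj n : injective (binom_conv n).
Proof. by elim: n => // n IH u v /shift_add_inj /IH. Qed.

(** Division undoes multiplication because one factor 1 + t turns the expansion
    of (1 + t)^(-n-1) into that of (1 + t)^(-n), by Pascal's rule. *)
Lemma binom_deconvK n u : binom_conv n (binom_deconv n u) = u.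
Proof.
elim: n => [|n IH]; first exact: binom_deconv0.
by rewrite /binom_conv iterSr shift_add_deconv.
Qed.

Lemma binom_convK n u : binom_deconv n (binom_conv n u) = u.
Proof. by apply: (@binom_conv_inj n); rewrite binom_deconvK. Qed.

Lemma binom_deconv_ext n u v p : (forall i, (i <= p)%N -> u i = v i) ->
  binom_deconv n u p = binom_deconv n v p.
Proof. by move=> uv; apply: eq_bigr => k _; rewrite uv // leq_subr. Qed.

Lemma binom_deconv_last n u p :
  binom_deconv n u p = u p + \sum_(1 <= k < p.+1) (-1) ^+ k * u (p - k)%N *+ 'C((n + k).-1, k).
Proof.
rewrite /binom_deconv big_ord_recl /= bin0 subn0 expr0 mul1r mulr1n; congr (_ + _).
by rewrite big_add1 /= big_mkord.
Qed.

(** The vanishing of a quotient at p expresses the coefficient at p through the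
    earlier ones: the inductive step of [slope_rule_uniq]. *)
Lemma binom_deconv_eq_last n u v p : (forall i, (i < p)%N -> u i = v i) ->
  binom_deconv n u p = 0 -> binom_deconv n v p = 0 -> u p = v p.
Proof.
move=> uv /eqP; rewrite binom_deconv_last addr_eq0 => /eqP -> /eqP.
rewrite binom_deconv_last addr_eq0 => /eqP ->; congr (- _).
rewrite !big_nat; apply: eq_bigr => k /andP[k0 kp].
by rewrite uv //; lia.
Qed.

Lemma binom_conv_coef n (E : {poly R}) :
  binom_conv n (fun q => E`_q) = fun q => ((1 + 'X) ^+ n * E)`_q.
Proof.
elim: n => [|n IH]; first by apply: funext => q; rewrite mul1r.
rewrite /binom_conv iterS -/(binom_conv n _) IH; apply: funext => q.
rewrite /shift_add exprS -mulrA mulrDl mul1r coefD coefXM.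
by case: q.
Qed.

Lemma binom_deconv_coef n (E : {poly R}) q :
  binom_deconv n (fun q => ((1 + 'X) ^+ n * E)`_q) q = E`_q.
Proof. by rewrite -binom_conv_coef binom_convK. Qed.

Lemma binom_convE n u p : binom_conv n u p = \sum_(k < p.+1) u (p - k)%N *+ 'C(n, k).
Proof.
elim: n p => [|n IH] p.
  rewrite big_ord_recl /= subn0 mulr1n big1 ?addr0 //.
rewrite /binom_conv iterS -/(binom_conv n _) /shift_add IH; case: p => [|p].
  by rewrite !big_ord1 !bin0 addr0.
rewrite IH big_ord_recl [RHS]big_ord_recl /= !bin0 -addrA; congr (_ + _).
rewrite -big_split /=; apply: eq_bigr => k _; rewrite /bump /= add1n subSS.
by rewrite binS mulrnDr.
Qed.

Lemma binom_conv_supp n u p : binom_conv n u p != 0 ->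
  exists2 k : nat, (k <= n)%N && (k <= p)%N & u (p - k)%N != 0.
Proof.
rewrite binom_convE => H; apply: contrapT => N; case/negP: H; apply/eqP.
apply: big1 => k _; have [kn|nk] := leqP k n; last by rewrite bin_small ?mulr0n.
have [->|u0] := eqVneq (u (p - k)%N) 0; first by rewrite mul0rn.
by case: N; exists (k : nat); rewrite // kn -ltnS ltn_ord.
Qed.

(** Since every truncation beyond K + n gives the same sum, the bound N of an
    expansion can be chosen freely. *)
Lemma binom_conv_powersum n u (K N : nat) (t : R) :
    (forall p, (K <= p)%N -> u p = 0) -> (K + n <= N)%N ->
  \sum_(p < N) binom_conv n u p * t ^+ p = (1 + t) ^+ n * \sum_(p < K) u p * t ^+ p.
Proof.
move=> uK; elim: n N => [|n IH] N KN.
  rewrite mul1r (@big_ord_widen _ _ _ K N (fun p => u p * t ^+ p)); last by lia.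
  rewrite [RHS]big_mkcond; apply: eq_bigr => p _ /=; case: ifPn => //.
  by rewrite -leqNgt => /uK ->; rewrite mul0r.
case: N KN => [|N] KN; first by lia.
have z : binom_conv n u N = 0.
  apply/eqP/negP => /negP /binom_conv_supp[k /andP[kn kN]] /negP; apply; apply/eqP.
  by apply: uK; lia.
rewrite exprS -mulrA -(IH N); last by lia.
rewrite /binom_conv iterS -/(binom_conv n u) mulrDl mul1r /shift_add.
under eq_bigr do rewrite mulrDl.
rewrite big_split /=; congr (_ + _).
  by rewrite big_ord_recr /= z mul0r addr0.
rewrite big_ord_recl mul0r add0r mulr_sumr; apply: eq_bigr => p _ /=.
by rewrite /bump /= add1n exprS mulrCA.
Qed.

End Deconvolution.

Lemma binom_conv_morph (R S : comNzRingType) (f : {rmorphism R -> S}) n (u : nat -> R) p :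
  f (binom_conv n u p) = binom_conv n (f \o u) p.
Proof.
rewrite !binom_convE rmorph_sum; apply: eq_bigr => k _ /=.
by rewrite rmorphMn.
Qed.

Lemma binom_deconv_morph (R S : comNzRingType) (f : {rmorphism R -> S}) n (u : nat -> R) p :
  f (binom_deconv n u p) = binom_deconv n (f \o u) p.
Proof.
rewrite /binom_deconv rmorph_sum; apply: eq_bigr => k _ /=.
by rewrite rmorphMn rmorphM rmorph_sign.
Qed.

Lemma binom_conv_ge0 n (u : nat -> int) p : (forall i, 0 <= u i) -> 0 <= binom_conv n u p.
Proof. by move=> u0; rewrite binom_convE sumr_ge0 // => k _; rewrite mulrn_wge0. Qed.

Lemma binom_conv_ge n (u : nat -> int) p : (forall i, 0 <= u i) -> u p <= binom_conv n u p.
Proof.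
move=> u0; rewrite binom_convE big_ord_recl /= bin0 subn0 mulr1n lerDl.
by rewrite sumr_ge0 // => k _; rewrite mulrn_wge0.
Qed.

(** * Walks with periodic steps *)

Definition psum (f : int -> int) (k : int) (n : nat) : int := \sum_(i < n) f (k + i%:Z).

Section PeriodicWalks.
Implicit Types (f g : int -> int) (k : int).

Lemma psum0 f k : psum f k 0 = 0. Proof. by rewrite /psum big_ord0. Qed.

Lemma psumSl f k n : psum f k n.+1 = f k + psum f (k + 1) n.
Proof.
rewrite /psum big_ord_recl addr0; congr (_ + _); apply: eq_bigr => i _.
by rewrite lift0; congr f; lia.
Qed.

Lemma psumSr f k n : psum f k n.+1 = psum f k n + f (k + n%:Z).
Proof. by rewrite /psum big_ord_recr. Qed.

Lemma psumD f k m n : psum f k (m + n) = psum f k m + psum f (k + m%:Z) n.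
Proof.
elim: n => [|n IH]; first by rewrite addn0 psum0 addr0.
by rewrite addnS !psumSr IH -addrA; congr (_ + (_ + f _)); lia.
Qed.

Lemma ler_psum f g k n : (forall i, f i <= g i) -> psum f k n <= psum g k n.
Proof. by move=> fg; apply: ler_sum. Qed.

(** At the first time m + 1 when the walk is negative, its last step is negative
    and so are all the sums over final segments, the initial ones being
    nonnegative. *)
Lemma first_passage f k n : psum f k n < 0 -> exists m : nat,
  [/\ (m < n)%N, f (k + m%:Z) < 0, psum f k m.+1 < 0, (forall i, (i <= m)%N -> 0 <= psum f k i)
    & forall i, (i <= m)%N -> psum f (k + i%:Z) (m.+1 - i) < 0].
Proof.
move=> sn; have ex : exists n, psum f k n < 0 by exists n.
case: (ex_minnP ex) => -[|m]; rewrite ?psum0 ?ltxx // => sm min.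
have ge i : (i <= m)%N -> 0 <= psum f k i.
  by move=> im; rewrite leNgt; apply/negP => /min; lia.
exists m; split => //.
- exact: min.
- by move: sm; rewrite psumSr; have := ge m (leqnn m); lia.
- move=> i im; move: sm; rewrite -{1}(subnKC (leqW im)) psumD.
  by have := ge i im; lia.
Qed.

Variables (N : nat) (N_gt0 : (0 < N)%N).
Definition periodic (T : Type) (f : int -> T) := forall k, f (k + N%:Z) = f k.

Lemma periodicM (T : Type) (f : int -> T) : periodic f ->
  forall k z, f (k + z * N%:Z) = f k.
Proof.
move=> pf k z.
have up n k' : f (k' + n%:Z * N%:Z) = f k'.
  elim: n => [|n IH]; first by rewrite mul0r addr0.
  by rewrite -IH -[in RHS]pf; congr f; lia.
case: (lerP 0 z) => z0; first by rewrite (_ : z = `|z|%N%:Z) ?up //; lia.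
rewrite -(up `|z|%N); congr f; rewrite -addrA -mulrDl.
by rewrite (_ : z + `|z|%N%:Z = 0) ?mul0r ?addr0 //; lia.
Qed.

Lemma periodic_mod (T : Type) (f : int -> T) : periodic f ->
  forall k y, f ((k %% N%:Z)%Z + y) = f (k + y).
Proof.
move=> pf k y; rewrite -[RHS](periodicM pf _ (- (k %/ N%:Z)%Z)).
by congr f; rewrite {2}(divz_eq k N%:Z); ring.
Qed.

Lemma psum_period f k : periodic f -> psum f k N = psum f 0 N.
Proof.
move=> pf.
have pp k' : psum f (k' + 1) N = psum f k' N.
  apply: (@addrI _ (f k')); rewrite -psumSl psumSr pf addrC //.
have up n k' : psum f (k' + n%:Z) N = psum f k' N.
  elim: n => [|n IH]; first by rewrite addr0.
  by rewrite -IH -[in RHS]pp; congr psum; lia.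
case: (lerP 0 k) => k0; first by rewrite -[RHS](up `|k|%N); congr psum; lia.
by rewrite -[LHS](up `|k|%N); congr psum; lia.
Qed.

(** How far the walk with steps f falls below its present value; over one
    period this is the whole drop as soon as the drift is nonnegative.  Seen from
    right to left, it is the number of unmatched requests when a step +1 offers
    one match and a step -b asks for b of them. *)
Definition depth f k : int := \big[Num.max/0]_(n < N.+1) - psum f k n.

Lemma depth_attained f k : exists2 n : nat, (n <= N)%N & depth f k = - psum f k n.
Proof.
rewrite /depth; apply: (big_ind (fun x => exists2 n : nat, (n <= N)%N & x = - psum f k n)).
- by exists 0%N; rewrite // psum0 oppr0.
- by move=> x y [n nN ->] [m mN ->]; rewrite maxEle; case: ifP => _; [exists m|exists n].
- by move=> n _; exists (n : nat); rewrite // -ltnS.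
Qed.

Lemma depth_ge f k n : (n <= N)%N -> - psum f k n <= depth f k.
Proof.
move=> nN; rewrite /depth (bigD1 (inord n)) //= inordK ?ltnS //.
by rewrite le_max lexx.
Qed.

Lemma depth_ge0 f k : 0 <= depth f k.
Proof. by rewrite -oppr0 -(psum0 f k); apply: depth_ge. Qed.

Lemma depth_periodic f : periodic f -> periodic (depth f).
Proof.
move=> pf k; apply: eq_bigr => n _; congr (- _); apply: eq_bigr => i _.
by rewrite -[in RHS]pf; congr f; lia.
Qed.

Lemma depth_gt0 f k n : (n <= N)%N -> psum f k n < 0 -> 0 < depth f k.
Proof. by move=> nN s; apply: lt_le_trans (depth_ge f k nN); rewrite oppr_gt0. Qed.

Section Drift.
Variables (f : int -> int) (pf : periodic f) (drift : 0 <= psum f 0 N).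

(** The recursion of a waiting line.  The drift enters when the lowest point is
    a full period away, where it is no lower than the starting point. *)
Lemma depth_rec k : depth f k = Num.max 0 (depth f (k + 1) - f k).
Proof.
apply/eqP; rewrite eq_le; apply/andP; split.
  have [[|n] nN ->] := depth_attained f k.
    by rewrite psum0 oppr0 le_max lexx.
  rewrite psumSl opprD addrC le_max; apply/orP; right; rewrite lerD2r.
  by apply: depth_ge; lia.
rewrite ge_max depth_ge0 /=.
have [n nN E] := depth_attained f (k + 1).
have [m mN ->] : exists2 m : nat, (m < N)%N & depth f (k + 1) = - psum f (k + 1) m.
  move: nN; rewrite leq_eqVlt => /orP[/eqP nN|nN]; last by exists n.
  exists 0%N => //; rewrite psum0 oppr0; apply/eqP; rewrite eq_le depth_ge0 andbT.
  by rewrite E nN psum_period // oppr_le0.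
by rewrite addrC -opprD -psumSl; apply: depth_ge.
Qed.

Lemma depth_step k : depth f (k + 1) <= depth f k + f k.
Proof. by rewrite [in X in _ <= X]depth_rec -lerBlDr le_max lexx orbT. Qed.

Lemma depth_psum k n : depth f (k + n%:Z) <= depth f k + psum f k n.
Proof.
elim: n => [|n IH]; first by rewrite psum0 !addr0.
rewrite psumSr addrA (_ : k + n.+1%:Z = k + n%:Z + 1); last by lia.
by apply: le_trans (depth_step _) _; rewrite lerD2r.
Qed.

Lemma depth_zero : exists2 n : nat, (n <= N)%N & depth f n%:Z = 0.
Proof.
have [n nN E] := depth_attained f 0; exists n => //.
by apply/eqP; rewrite eq_le depth_ge0 andbT; have := depth_psum 0 n; rewrite E add0r addNr.
Qed.

(** The depth vanishes at the lowest points of the walk, so it is not positive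
    everywhere and, being periodic, it has to rise from 0 if it is not
    identically 0. *)
Lemma depth_rise k : 0 < depth f k -> exists2 j, depth f j = 0 & 0 < depth f (j + 1).
Proof.
move=> dk; apply: contrapT => H.
have [n _ dn] := depth_zero.
have all0 m : depth f (n%:Z + m%:Z) = 0.
  elim: m => [|m IH]; first by rewrite addr0.
  rewrite (_ : n%:Z + m.+1%:Z = n%:Z + m%:Z + 1); last by lia.
  apply/eqP; rewrite eq_le depth_ge0 andbT leNgt; apply/negP => d.
  by apply: H; exists (n%:Z + m%:Z).
have E : depth f k = 0.
  rewrite -(periodicM (depth_periodic pf) k (`|k - n%:Z|%N%:Z)).
  rewrite -(all0 (absz ((k - n%:Z) + `|k - n%:Z|%N%:Z * N%:Z))); congr depth.
  (* k is moved beyond n by a multiple of the period before all0 is used *)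
  by have := N_gt0; nia.
by rewrite E ltxx in dk.
Qed.

End Drift.

End PeriodicWalks.

(** * The maximal Dyck path *)

Section Positions.
Variable M : nat.
Local Notation N := M.+1.

Definition pos (k : int) : 'I_N := inord `|(k %% N%:Z)%Z|%N.

Lemma pos_val k : (pos k)%:Z = (k %% N%:Z)%Z.
Proof.
have k0 : (0 <= k %% N%:Z)%Z by rewrite modz_ge0.
have kN : (k %% N%:Z < N%:Z)%Z by apply: ltz_pmod.
by rewrite inordK; lia.
Qed.

Lemma pos_ord (i : 'I_N) : pos i%:Z = i.
Proof.
have := pos_val i%:Z; rewrite modz_small; last by have := ltn_ord i; lia.
by move=> [] E; apply: val_inj.
Qed.

Lemma pos_periodic : periodic N pos.
Proof. by move=> k; rewrite /pos modzDr. Qed.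

Lemma pos_rev k : pos (- 1 - k) = rev_ord (pos k).
Proof.
apply: val_inj; rewrite /=; have := pos_val (- 1 - k); have E1 := pos_val k.
have -> : ((- 1 - k) %% N%:Z)%Z = N%:Z - 1 - (pos k)%:Z.
  rewrite E1; have := divz_eq k N%:Z.
  have k0 : (0 <= k %% N%:Z)%Z by rewrite modz_ge0.
  have kN : (k %% N%:Z < N%:Z)%Z by apply: ltz_pmod.
  move: k0 kN; set r := (k %% _)%Z; set q := (k %/ _)%Z => k0 kN ->.
  rewrite (_ : - 1 - (q * N + r) = (- q - 1) * N%:Z + (N%:Z - 1 - r)); last by ring.
  by rewrite modzMDl modz_small //; lia.
by have := ltn_ord (pos k); lia.
Qed.

(** Reading the path backwards exchanges its two kinds of edges, and this
    reversal is what makes rows and columns symmetric. *)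
Definition rev_set (S : {set 'I_N}) : {set 'I_N} := [set i | rev_ord i \in S].

Lemma rev_setK : involutive rev_set.
Proof. by move=> S; apply/setP => i; rewrite !inE rev_ordK. Qed.

Lemma card_rev_set S : #|rev_set S| = #|S|.
Proof.
rewrite -(card_imset _ (@rev_ord_inj N)); congr #|pred_of_set _|; apply/setP => i.
apply/imsetP/idP => [[j]|iS]; first by rewrite inE => jS ->.
by exists (rev_ord i); rewrite ?inE rev_ordK.
Qed.

Lemma mem_rev_set S k : (pos (- 1 - k) \in rev_set S) = (pos k \in S).
Proof. by rewrite inE pos_rev rev_ordK. Qed.

Lemma rev_set_sub (S T : {set 'I_N}) : (rev_set S \subset T) = (S \subset rev_set T).
Proof.
apply/subsetP/subsetP => ST i iS.
  by rewrite inE ST // inE rev_ordK.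
by have := ST (rev_ord i); rewrite !inE rev_ordK in iS *; apply.
Qed.

Lemma card_psum (S : {set 'I_N}) : psum (fun k => (pos k \in S)%:Z) 0 N = #|S|%:Z.
Proof.
rewrite /psum -sum1_card -natz natr_sum [RHS]big_mkcond /=.
apply: eq_bigr => i _; rewrite add0r pos_ord.
by case: (i \in S).
Qed.

End Positions.

Section DyckPath.
Variables h w : nat.
Hypothesis (h_gt0 : (0 < h)%N) (w_gt0 : (0 < w)%N).
Local Notation N := (h + w)%N.

(** The edges of the maximal Dyck path are read off from k w modulo h + w, which
    measures how far its k-th vertex lies below the diagonal: the path goes
    horizontally while this leaves room for w more, and vertically otherwise.
    The path is extended periodically to all integers k. *)
Definition height (k : int) : int := ((k * w%:Z) %% (h + w)%N%:Z)%Z.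
Definition horiz (k : int) : bool := height k < h%:Z.

Lemma height_ge0 k : 0 <= height k.
Proof. by apply: modz_ge0; lia. Qed.

Lemma height_lt k : height k < N%:Z.
Proof. by apply: ltz_pmod; lia. Qed.

Lemma height_mod (k r q : int) : k * w%:Z = q * N%:Z + r -> 0 <= r < N%:Z -> height k = r.
Proof. by move=> E r0; rewrite /height E modzMDl modz_small //; lia. Qed.

Lemma heightS k : height (k + 1) = height k + (if horiz k then w%:Z else - h%:Z).
Proof.
have E : k * w%:Z = (k * w%:Z %/ N%:Z)%Z * N%:Z + height k by exact: divz_eq.
have g0 := height_ge0 k; have gN := height_lt k.
rewrite /horiz; case: ltrP => H; last first.
  apply: (@height_mod _ _ ((k * w%:Z %/ N%:Z)%Z + 1)); last by lia.
  by rewrite mulrDl {1}E PoszD; ring.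
apply: (@height_mod _ _ (k * w%:Z %/ N%:Z)%Z); last by lia.
by rewrite mulrDl {1}E; ring.
Qed.

Lemma height_periodic : periodic N height.
Proof. by move=> k; rewrite /height mulrDl addrC (mulrC N%:Z) modzMDl. Qed.

Lemma horiz_periodic : periodic N horiz.
Proof. by move=> k; rewrite /horiz height_periodic. Qed.

End DyckPath.

Lemma horiz_rev h w (h_gt0 : (0 < h)%N) (w_gt0 : (0 < w)%N) k :
  horiz w h (- 1 - k) = ~~ horiz h w k.
Proof.
have E : height w h (- 1 - k) = height h w (k + 1).
  have E := divz_eq ((k + 1) * w%:Z) (h + w)%N%:Z.
  apply: (@height_mod _ _ _ _ ((((k + 1) * w%:Z) %/ (h + w)%N%:Z)%Z - (k + 1))).
    rewrite (addnC w h) -/(height h w (k + 1)) in E *.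
    have -> : height h w (k + 1) =
      (k + 1) * w%:Z - ((k + 1) * w%:Z %/ (h + w)%N%:Z)%Z * (h + w)%N%:Z.
      by rewrite [X in _ = X - _]E; ring.
    by rewrite mulrBl [in X in _ = X](PoszD h w); ring.
  by rewrite height_ge0 // addnC height_lt.
rewrite {1}/horiz E heightS //.
have g0 : 0 <= height h w k by apply: height_ge0.
have gN : height h w k < (h + w)%N%:Z by apply: height_lt.
by rewrite /horiz; case: (ltrP (height h w k) h%:Z) => ? /=; lia.
Qed.

(** * Shadows and compatible pairs *)

Section Shadows.
Variable M : nat.
Local Notation N := M.+1.
Implicit Types (h w b c : nat) (S : {set 'I_N}) (k : int).

Definition horiz_set h w : {set 'I_N} := [set i : 'I_N | horiz h w i%:Z].

(** Each edge of S is to be matched with b horizontal edges on its left. *)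
Definition match_step h w b S k : int :=
  if horiz h w k then 1 else if pos M k \in S then - b%:Z else 0.

(** The horizontal edges which are matched with an edge of S, as in a system of
    parentheses. *)
Definition shadow h w b S : {set 'I_N} :=
  [set i in horiz_set h w | 0 < depth N (match_step h w b S) (i%:Z + 1)].

(** The edges u in S1 and v = u + n in S2 are in conflict when each of them lies
    in the shadow of the other; the sums run over the final segments of the path
    between them for S2, and over the initial ones, read backwards, for S1. *)
Definition conflict h w b c S1 S2 (u : int) (n : nat) : bool :=
  [&& pos M u \in S1, pos M (u + n%:Z) \in S2 &
   [forall j : 'I_n, (psum (match_step h w b S2) (u + 1 + j%:Z) (n - j) < 0) &&
                     (psum (match_step w h c (rev_set S1)) (- (u + 1 + j%:Z)) j.+1 < 0)]].

Definition compatible h w b c S1 S2 : bool :=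
  [forall u : 'I_N, forall n : 'I_N.+1, ~~ conflict h w b c S1 S2 u%:Z n].

Variables (h w : nat) (h_gt0 : (0 < h)%N) (w_gt0 : (0 < w)%N) (NE : N = (h + w)%N).

Lemma mem_horiz_set k : (pos M k \in horiz_set h w) = horiz h w k.
Proof.
rewrite inE pos_val -[(k %% _)%Z]addr0 NE periodic_mod ?addr0 ?addn_gt0 ?h_gt0 //.
exact: horiz_periodic.
Qed.

Lemma match_step_periodic b S : periodic N (match_step h w b S).
Proof.
move=> k; rewrite /match_step pos_periodic.
by have := @horiz_periodic h w; rewrite -NE => ->.
Qed.

Lemma mem_shadow b S k : (pos M k \in shadow h w b S) =
  horiz h w k && (0 < depth N (match_step h w b S) (k + 1)).
Proof.
rewrite inE mem_horiz_set pos_val.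
by rewrite (periodic_mod (ltn0Sn M) (depth_periodic (ltn0Sn M) (@match_step_periodic b S))).
Qed.

Lemma shadow_sub_horiz b S : shadow h w b S \subset horiz_set h w.
Proof. by apply/subsetP => i; rewrite inE => /andP[]. Qed.

(** The heights telescope to 0 over a period. *)
Lemma card_horiz_set : #|horiz_set h w| = h.
Proof.
have := psum_period (ltn0Sn M) 1 (f := height h w) _.
have pH : periodic N (height h w) by rewrite NE; apply: height_periodic.
move=> /(_ pH) E.
have : psum (fun k => (h + w)%N%:Z * (pos M k \in horiz_set h w)%:Z - h%:Z) 0 N = 0.
  transitivity (psum (height h w) 1 N - psum (height h w) 0 N); last by rewrite E subrr.
  rewrite /psum -sumrB; apply: eq_bigr => i _.
  rewrite mem_horiz_set addrC [0 + _]addrC addr0 [1 + _]addrC heightS // addrAC subrr add0r.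
  by case: horiz; lia.
rewrite /psum sumrB -mulr_sumr sumr_const card_ord.
have := card_psum (horiz_set h w); rewrite /psum => ->.
by rewrite -mulr_natr; nia.
Qed.

Lemma match_step_drift b S : S \subset ~: horiz_set h w ->
  psum (match_step h w b S) 0 N = h%:Z - (b * #|S|)%N%:Z.
Proof.
move=> /subsetP SV; rewrite -{2}card_horiz_set PoszM -!card_psum /psum mulr_sumr -sumrB.
apply: eq_bigr => i _; rewrite mem_horiz_set /match_step; case: ifPn => hi.
  have /negbTE -> : pos M (0 + i%:Z) \notin S.
    by apply/negP => /SV; rewrite inE mem_horiz_set hi.
  by rewrite mulr0 subr0.
by case: (_ \in S); rewrite /= ?mulr1 ?mulr0 ?subrr ?sub0r.
Qed.

(** The depth returns to its value after a period, and it changes by b at each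
    edge of S and by -1 at each edge of the shadow. *)
Lemma card_shadow b S : S \subset ~: horiz_set h w -> (b * #|S| <= h)%N ->
  #|shadow h w b S| = (b * #|S|)%N.
Proof.
move=> SV bS; have /subsetP SV' := SV.
have pf := match_step_periodic b S; have pd := depth_periodic (ltn0Sn M) pf.
have drift : 0 <= psum (match_step h w b S) 0 N by rewrite match_step_drift //; lia.
have E := psum_period (ltn0Sn M) 1 pd.
have : psum (fun k => b%:Z * (pos M k \in S)%:Z - (pos M k \in shadow h w b S)%:Z) 0 N = 0.
  pose D := depth N (match_step h w b S).
  transitivity (psum D 0 N - psum D 1 N); last by rewrite E subrr.
  rewrite /D /psum -sumrB; apply: eq_bigr => i _.
  rewrite mem_shadow ![_ + i%:Z]addrC addr0 [in RHS](depth_rec (ltn0Sn M) pf drift).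
  have d0 := depth_ge0 N (match_step h w b S) (i%:Z + 1).
  rewrite {2 3}/match_step; case: ifPn => hi /=.
    have /negbTE -> : pos M i%:Z \notin S.
      by apply/negP => /SV'; rewrite inE mem_horiz_set hi.
    by move: d0; set d := depth _ _ _; lia.
  by move: d0; set d := depth _ _ _; case: (_ \in S) => /=; lia.
rewrite /psum sumrB -mulr_sumr.
have := card_psum S; have := card_psum (shadow h w b S); rewrite /psum => -> ->.
by lia.
Qed.

(** With a negative drift every horizontal edge is matched within one period. *)
Lemma shadow_all b S : S \subset ~: horiz_set h w -> (h < b * #|S|)%N ->
  shadow h w b S = horiz_set h w.
Proof.
move=> SV bS; apply/setP => i; rewrite inE; case: (i \in _) => //=.
apply: (@depth_gt0 _ _ _ N) => //.
by rewrite (psum_period (ltn0Sn M) _ (match_step_periodic b S)) match_step_drift //; lia.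
Qed.

Lemma shadow_ge b S : S \subset ~: horiz_set h w -> (minn h (b * #|S|) <= #|shadow h w b S|)%N.
Proof.
move=> SV; have [bS|bS] := leqP (b * #|S|)%N h; first by rewrite card_shadow //.
by rewrite shadow_all // card_horiz_set.
Qed.

End Shadows.

Section Compatible.
Variables (M h w : nat).
Local Notation N := M.+1.
Hypotheses (h_gt0 : (0 < h)%N) (w_gt0 : (0 < w)%N) (NE : N = (h + w)%N).
Let NE' : N = (w + h)%N. Proof. by rewrite addnC. Qed.
Variables b c : nat.
Implicit Types (S : {set 'I_N}) (u k : int).

Lemma conflict_periodic S1 S2 u n z :
  conflict h w b c S1 S2 (u + z * N%:Z) n = conflict h w b c S1 S2 u n.
Proof.
have pM (f : int -> int) k z' m : periodic N f -> psum f (k + z' * N%:Z) m = psum f k m.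
  move=> pf; apply: eq_bigr => i _.
  by rewrite addrAC (periodicM (ltn0Sn M) pf).
have pp := periodicM (ltn0Sn M) (@pos_periodic M).
rewrite /conflict addrAC !pp; congr [&& _, _ & _]; apply: eq_forallb => j.
rewrite (_ : u + z * N%:Z + 1 + j%:Z = u + 1 + j%:Z + z * N%:Z); last by ring.
rewrite pM; last exact: match_step_periodic.
rewrite opprD -mulNr pM //; exact: match_step_periodic.
Qed.

Lemma compatibleP S1 S2 :
  reflect (forall u n, (n <= N)%N -> ~~ conflict h w b c S1 S2 u n)
          (compatible h w b c S1 S2).
Proof.
apply: (iffP forallP) => [H u n nN | H u]; last first.
  by apply/forallP => n; apply: H; rewrite -ltnS.
have /forallP/(_ (inord n)) := H (pos M u).
rewrite inordK ?ltnS // pos_val; apply: contra.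
by rewrite {1}(divz_eq u N%:Z) addrC conflict_periodic.
Qed.

(** Between u and v all the final sums are negative, so no horizontal edge there
    escapes the shadow. *)
Lemma conflict_shadow S1 S2 u n j : (n <= N)%N -> conflict h w b c S1 S2 u n ->
  (j < n)%N -> horiz h w (u + j%:Z) -> pos M (u + j%:Z) \in shadow h w b S2.
Proof.
move=> nN /and3P[_ _ /forallP H] jn hj; rewrite mem_shadow // hj /=.
have /andP[H1 _] := H (Ordinal jn).
apply: (@depth_gt0 _ _ _ (n - j)%N); first by lia.
by rewrite (_ : u + j%:Z + 1 = u + 1 + j%:Z) //; lia.
Qed.

(** Fewer edges in S1 cast a smaller shadow. *)
Lemma compatible_sub S1 S1' S2 : S1' \subset S1 ->
  compatible h w b c S1 S2 -> compatible h w b c S1' S2.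
Proof.
move=> /subsetP SS /compatibleP H; apply/compatibleP => u n nN.
apply: contra (H u n nN) => /and3P[uS vS /forallP F]; apply/and3P; split => //.
  exact: SS.
apply/forallP => j; have /andP[-> Fj] := F j; apply: le_lt_trans Fj.
apply: ler_psum => i; rewrite /match_step; case: ifP => // _.
rewrite !inE; case: ifP => [_|/negbT I]; first by case: ifP => //; lia.
by rewrite ifN //; apply: contra I => /SS.
Qed.

(** Edges of S1 outside the shadow of S2 cannot take part in a conflict, nor lie
    between the two edges of one: the horizontal edges of that segment are all
    shadowed. *)
Lemma compatible_shadow S1 S2 : S1 \subset horiz_set M h w -> S2 \subset ~: horiz_set M h w ->
  compatible h w b c S1 S2 = compatible h w b c (S1 :&: shadow h w b S2) S2.
Proof.
move=> /subsetP S1H /subsetP S2V; apply/idP/idP.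
  by apply: compatible_sub; apply: subsetIl.
move=> /compatibleP H; apply/compatibleP => u n nN.
apply: contra (H u n nN) => C; have CS := conflict_shadow nN C.
have /and3P[uS vS /forallP F] := C.
have hu : horiz h w u by rewrite -(mem_horiz_set h_gt0 NE) S1H.
have n0 : (0 < n)%N.
  by case: n vS {H nN C CS F} => // /S2V; rewrite addr0 inE S1H.
apply/and3P; split => //.
  by rewrite in_setI uS -[u]addr0; apply: CS; rewrite ?addr0.
apply/forallP => j; have /andP[-> Fj] := F j; move: Fj; congr (_ < 0).
apply: eq_bigr => i _; rewrite /match_step; case: ifP => // hi.
have -> : - (u + 1 + j%:Z) + i%:Z = - 1 - (u + (j - i)%N%:Z) by have := ltn_ord i; lia.
rewrite !mem_rev_set in_setI; case: (boolP (_ \in S1)) => //= tS.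
rewrite CS //; first by have := ltn_ord j; lia.
by rewrite -(mem_horiz_set h_gt0 NE) S1H.
Qed.

(** If S1 lies in the shadow of S2 and the pair is compatible, the shadow cast by
    S1 on the vertical edges stays inside the segments shadowed by S2: the edge u
    of S1 that shadows k is itself shadowed by an edge v of S2, and v cannot come
    before k since u would then be in conflict with it. *)
Lemma shadow_inside S1 S2 k : S1 \subset shadow h w b S2 -> compatible h w b c S1 S2 ->
    0 < depth N (match_step w h c (rev_set S1)) (- k) ->
  0 < depth N (match_step h w b S2) (k + 1).
Proof.
move=> /subsetP S1sh /compatibleP comp d1.
set f2 := match_step h w b S2; set f1 := match_step w h c (rev_set S1) in d1.
have [n nN E1] := depth_attained N f1 (- k).
have /first_passage[m [mn f1m _ _ sm]] : psum f1 (- k) n < 0 by rewrite -oppr_gt0 -E1.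
pose u := k - m%:Z - 1.
have uS : pos M u \in S1.
  move: f1m; rewrite /f1 /match_step; case: ifP => // _.
  rewrite (_ : - k + m%:Z = - 1 - u); last by rewrite /u; lia.
  by rewrite mem_rev_set; case: ifP.
have := S1sh _ uS; rewrite mem_shadow // => /andP[_ du].
have [n' n'N E2] := depth_attained N f2 (u + 1).
have /first_passage[m' [m'n f2m _ _ sm']] : psum f2 (u + 1) n' < 0.
  by rewrite -oppr_gt0 -E2.
have [mm'|m'm] := ltnP m m'.
  have {sm'} := sm' m.+1 mm'.
  rewrite (_ : u + 1 + m.+1%:Z = k + 1) => [s|]; last by rewrite /u; lia.
  by apply: (depth_gt0 _ s); lia.
(* v = u + m' + 1 lies between u and k, within the shadow of u *)
case/negP: (comp u m'.+1 (leq_trans m'n n'N)); apply/and3P; split => //.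
  move: f2m; rewrite /f2 /match_step; case: ifP => // _.
  by rewrite (_ : u + 1 + m'%:Z = u + m'.+1%:Z); [case: ifP | lia].
apply/forallP => j; have jm' := ltn_ord j; rewrite sm' //=.
have := sm (m - j)%N (leq_subr _ _).
rewrite (_ : - k + (m - j)%N%:Z = - (u + 1 + j%:Z)); last by rewrite /u; lia.
by rewrite (_ : m.+1 - (m - j) = j.+1)%N //; lia.
Qed.

(** The slope condition.  Let J be the set of edges k at which the depth of the
    matching for S2 is positive just after k.  A segment of J starts with a
    horizontal edge, where the height is less than h, and it is followed by a
    vertical edge, where the height is at least h.  So the height gained over J
    is positive.  That gain is w times the number b|S2| of horizontal edges of
    J, minus h times the number of its vertical edges, which include the shadow
    of S1 by [shadow_inside]. *)
Lemma shadow_slope S1 S2 : S1 \subset shadow h w b S2 -> S2 \subset ~: horiz_set M h w ->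
    compatible h w b c S1 S2 -> (0 < b * #|S2|)%N -> (b * #|S2| <= h)%N ->
  (h * (c * #|S1|) < w * (b * #|S2|))%N.
Proof.
move=> S1sh S2V comp S20 S2h.
pose f2 := match_step h w b S2; pose d := depth N f2.
have pf : periodic N f2 by apply: match_step_periodic.
have pd : periodic N d by apply: depth_periodic.
have drift : 0 <= psum f2 0 N by rewrite match_step_drift //; lia.
have pH : periodic N (height h w) by rewrite NE; apply: height_periodic.
pose J k : int := (0 < d (k + 1))%R%:Z.
pose T k := J k * (height h w (k + 1) - height h w k).
pose g k := J (k - 1) * (height h w k - h%:Z).
pose r k := (J (k - 1) - J k) * (height h w k - h%:Z).
have pJ : periodic N J by move=> k; rewrite /J addrAC pd.
have pr : periodic N r by move=> k; rewrite /r addrAC !pJ pH.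
(* summation by parts; the constant h is harmless since J is periodic *)
have TE : psum T 0 N = psum r 0 N.
  have : psum g 1 N = psum g 0 N.
    by rewrite psum_period // => k; rewrite /g addrAC pJ pH.
  have D : psum T 0 N - psum r 0 N = psum g 1 N - psum g 0 N.
    rewrite /psum -!sumrB; apply: eq_bigr => i _.
    rewrite /T /r /g (_ : 1 + i%:Z = 0 + i%:Z + 1); last by rewrite addrC add0r.
    by rewrite addrK; ring.
  by move=> g0; apply/eqP; rewrite -subr_eq0 D g0 subrr.
have r_ge0 k : 0 <= r k /\ (d k = 0 -> 0 < d (k + 1) -> 0 < r k).
  rewrite /r /J subrK.
  have dk : d k = Num.max 0 (d (k + 1) - f2 k) by exact: depth_rec.
  have d0 : 0 <= d k by exact: depth_ge0.
  have d1 : 0 <= d (k + 1) by exact: depth_ge0.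
  move: dk; rewrite {1}/f2 /match_step; case: ifPn; rewrite /horiz => hk.
    move: d0 d1 hk; set x := d k; set y := d (k + 1); set z := height h w k.
    by case: (ltrP 0 x); case: (ltrP 0 y) => /=; nia.
  move: d0 d1 hk; set x := d k; set y := d (k + 1); set z := height h w k.
  by case: ifP => _; case: (ltrP 0 x); case: (ltrP 0 y) => /=; nia.
have sh_card : #|shadow h w b S2| = (b * #|S2|)%N by apply: card_shadow.
have T_gt0 : 0 < psum T 0 N.
  have [i ish] : exists i, i \in shadow h w b S2 by apply/card_gt0P; rewrite sh_card.
  have : 0 < d (i%:Z + 1) by move: ish; rewrite inE => /andP[].
  move=> /(depth_rise (ltn0Sn M) pf drift) [j dj dj1].
  rewrite TE /psum (bigD1 (pos M j)) //= ltr_pwDl //; last first.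
    by apply: sumr_ge0 => k _; case: (r_ge0 (0 + k%:Z)).
  rewrite add0r pos_val -[(j %% _)%Z]addr0 (periodic_mod (ltn0Sn M) pr) addr0.
  by case: (r_ge0 j) => _; apply.
pose S1' := shadow w h c (rev_set S1).
have T_le : psum T 0 N <= w%:Z * #|shadow h w b S2|%:Z - h%:Z * #|S1'|%:Z.
  rewrite -(card_rev_set S1') -!card_psum /psum !mulr_sumr -sumrB.
  apply: ler_sum => i _; set k := 0 + i%:Z; rewrite /T heightS // addrAC subrr add0r.
  have -> : (pos M k \in rev_set S1') = (pos M (- 1 - k) \in S1').
    by rewrite -(mem_rev_set (rev_set S1')) rev_setK.
  rewrite !mem_shadow // horiz_rev // (_ : - 1 - k + 1 = - k); last by ring.
  rewrite -/f2 -/d /J; case: ifP => hk /=; first by case: (0 < d _); rewrite /=; lia.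
  case: (boolP (0 < depth _ _ _)) => [/(shadow_inside S1sh comp)|_].
    by rewrite -/f2 -/d => ->; lia.
  by case: (0 < d _); rewrite /=; lia.
have S1V : rev_set S1 \subset ~: horiz_set M w h.
  apply/subsetP => i; rewrite inE => /(subsetP S1sh).
  move=> /(subsetP (shadow_sub_horiz h w b S2)).
  rewrite -[rev_ord i]pos_ord (mem_horiz_set h_gt0 NE) => hi.
  have -> : i = pos M (- 1 - (rev_ord i)%:Z) by rewrite pos_rev pos_ord rev_ordK.
  by rewrite inE (mem_horiz_set w_gt0 NE') horiz_rev // hi.
(* when c|S1| exceeds w all the vertical edges are shadowed and b|S2| would
   exceed h, so the minimum in shadow_ge is c|S1| *)
have := shadow_ge w_gt0 h_gt0 NE' c S1V; rewrite card_rev_set -/S1'.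
by move: T_gt0 T_le; rewrite sh_card; nia.
Qed.

End Compatible.

(** The definition of a conflict is symmetric under reversal of the path, which
    exchanges the two kinds of edges. *)
Lemma compatible_rev M h w b c (h_gt0 : (0 < h)%N) (w_gt0 : (0 < w)%N)
    (NE : M.+1 = (h + w)%N) (S1 S2 : {set 'I_M.+1}) :
  compatible w h c b (rev_set S2) (rev_set S1) = compatible h w b c S1 S2.
Proof.
wlog suff: h w b c h_gt0 w_gt0 NE S1 S2 / compatible h w b c S1 S2 ->
    compatible w h c b (rev_set S2) (rev_set S1).
  move=> H; apply/idP/idP; last exact: H.
  by move/H; rewrite !rev_setK; apply; rewrite // addnC.
move/(compatibleP NE) => H.
have NE' : M.+1 = (w + h)%N by rewrite addnC.
apply/(compatibleP NE') => u n nN.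
apply: contra (H (- 1 - (u + n%:Z)) n nN) => /and3P[uS vS /forallP F].
apply/and3P; split.
- by rewrite -mem_rev_set (_ : - 1 - (- 1 - (u + n%:Z)) = u + n%:Z) //; ring.
- by rewrite -mem_rev_set (_ : - 1 - (- 1 - (u + n%:Z) + n%:Z) = u) //; ring.
apply/forallP => j; have jn := ltn_ord j.
have jn' : (n.-1 - j < n)%N by lia.
have /andP[] := F (Ordinal jn'); rewrite rev_setK /= => F1 F2.
apply/andP; split.
  move: F2; rewrite (_ : (n.-1 - j).+1 = n - j)%N; last by lia.
  by congr (psum _ _ _ < 0); lia.
move: F1; rewrite (_ : n - (n.-1 - j) = j.+1)%N; last by lia.
by congr (psum _ _ _ < 0); lia.
Qed.

(** * Counting compatible pairs *)

(** When membership in a family depends only on the part of the set inside D,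
    the part outside D is chosen freely. *)
Lemma card_free_part (T : finType) (H D : {set T}) (P : pred {set T}) (q : nat) :
    D \subset H -> (forall A : {set T}, A \subset H -> P A = P (A :&: D)) ->
  #|[set A : {set T} | [&& A \subset H, #|A| == q & P A]]| =
  (\sum_(k < q.+1) #|[set A : {set T} | [&& A \subset D, #|A| == q - k & P A]]|
                   * 'C(#|H| - #|D|, k))%N.
Proof.
move=> DH PD.
pose F (A : {set T}) : 'I_q.+1 := inord #|A :\: D|.
rewrite -sum1_card (partition_big F xpredT) //=; apply: eq_bigr => k _.
have kq : (k <= q)%N by rewrite -ltnS.
rewrite sum1_card -cardsDS // -cards_draws -cardsX.
pose U (s : {set T} * {set T}) := s.1 :|: s.2.
rewrite -[RHS](@card_in_imset _ _ U); last first.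
  move=> [A B] [A' B']; rewrite !inE /= => /andP[/and3P[AD _ _] /andP[BH _]].
  move=> /andP[/and3P[AD' _ _] /andP[BH' _]] /setP E.
  have EE : (A =i A') /\ (B =i B').
    split=> y; have := E y; rewrite !inE;
    move: (subsetP AD y) (subsetP AD' y) (subsetP BH y)
      (subsetP BH' y); rewrite !inE;
    case: (y \in A); case: (y \in A'); case: (y \in B); case: (y \in B');
    case: (y \in D) => //= h1 h2 h3 h4;
    do ?[by have := h1 isT | by have := h2 isT | by have := h3 isT | by have := h4 isT].
  by congr pair; apply/setP; case: EE.
apply: eq_card => A; rewrite [LHS]inE /= [in LHS]inE.
apply/andP/imsetP => [[/and3P[AH /eqP Aq PA] /eqP Fk] | [[B C]]].
  have AD : (#|A :\: D| <= q)%N by rewrite -Aq subset_leq_card // subsetDl.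
  have kE : #|A :\: D| = k by rewrite -Fk /F inordK.
  exists (A :&: D, A :\: D); last by rewrite /U /= setID.
  rewrite !inE /= kE eqxx andbT subsetIr -PD // PA andbT.
  by rewrite setSD // andbT; have := cardsID D A; rewrite Aq kE; lia.
rewrite !inE /= => /andP[/and3P[BD /eqP Bq PB] /andP[CH /eqP Ck]] ->.
rewrite /U /=; have CD : C :&: D = set0.
  apply/setP => x; rewrite !inE; apply/negP => /andP[xC xD].
  by have := subsetP CH x xC; rewrite !inE xD.
have BI : B :&: D = B by apply/setIidPl.
have BC : B :&: C = set0.
  apply/setP => x; rewrite !inE; apply/negP => /andP[xB xC].
  by have := subsetP CH x xC; rewrite !inE (subsetP BD).
have BH : B \subset H by apply: subset_trans DH.
have CH' : C \subset H by apply: subset_trans CH (subsetDl _ _).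
split.
  rewrite subUset BH CH' PD ?subUset ?BH // setIUl CD setU0 BI PB.
  by rewrite andbT cardsU BC cards0 subn0 Bq Ck subnK ?eqxx.
rewrite /F setDUl; have /eqP -> : B :\: D == set0 by rewrite setD_eq0.
have -> : C :\: D = C by apply/setDidPl; rewrite -setI_eq0 CD.
by rewrite set0U Ck inord_val.
Qed.

Section CompatiblePairs.
Variables (M h w : nat).
Local Notation N := M.+1.
Hypotheses (h_gt0 : (0 < h)%N) (w_gt0 : (0 < w)%N) (NE : N = (h + w)%N).
Variables (b c : nat).
Implicit Types (S : {set 'I_N}).

Definition path_pair h w b c p q (S1 S2 : {set 'I_N}) : bool :=
  [&& S1 \subset horiz_set M h w, S2 \subset ~: horiz_set M h w, #|S1| == q, #|S2| == p
    & compatible h w b c S1 S2].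

Definition pair_count h w b c (p q : nat) : nat :=
  (\sum_(S2 : {set 'I_N}) \sum_(S1 : {set 'I_N}) path_pair h w b c p q S1 S2)%N.

(** Compatible pairs in which S1 has no free edge: these give the column
    quotients. *)
Definition core_count h w b c (p q : nat) : nat :=
  (\sum_(S2 : {set 'I_N}) \sum_(S1 : {set 'I_N})
     (path_pair h w b c p q S1 S2 && (S1 \subset shadow h w b S2)))%N.

Lemma sum_nat_gt0P (I : finType) (F : I -> nat) :
  (\sum_i F i)%N != 0%N -> exists i, F i != 0%N.
Proof.
rewrite sum_nat_eq0 negb_forall => /existsP[i Fi]; by exists i.
Qed.

Lemma pair_countP p q : pair_count h w b c p q != 0%N ->
  exists S1 S2, path_pair h w b c p q S1 S2.
Proof.
move=> /sum_nat_gt0P[S2 /sum_nat_gt0P[S1 H]]; exists S1, S2.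
by case: path_pair H.
Qed.

Lemma pair_count_le p q : (h < q)%N -> pair_count h w b c p q = 0%N.
Proof.
move=> hq; apply/eqP/negP => /negP /pair_countP[S1 [S2 /and5P[S1H _ /eqP S1q _ _]]].
by have := subset_leq_card S1H; rewrite (card_horiz_set h_gt0 w_gt0 NE) S1q leqNgt hq.
Qed.

Lemma core_slope p q : (0 < b)%N -> (b * p <= h)%N -> core_count h w b c p q != 0%N ->
  (p == 0%N) && (q == 0%N) \/ (h * (c * q) < w * (b * p))%N.
Proof.
move=> b0 bp /sum_nat_gt0P[S2 /sum_nat_gt0P[S1]].
case: (boolP (_ && _)) => // /andP[/and5P[S1H S2V /eqP S1q /eqP S2p comp] S1sh] _.
case: p => [|p] in bp S2p *.
  left; rewrite /= -S1q cards_eq0 -subset0; apply: subset_trans S1sh _.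
  by rewrite subset0 -cards_eq0 (card_shadow h_gt0 w_gt0 NE) ?S2p ?muln0.
by right; rewrite -S1q -S2p; apply: (shadow_slope h_gt0 w_gt0 NE); rewrite // S2p; lia.
Qed.

(** This is the factorization of the column polynomial by (1+s)^(h-bp), for one
    S2 at a time: the shadow of S2 has bp edges, and the h - bp others are free
    by [compatible_shadow]. *)
Lemma pair_count_core p q : (b * p <= h)%N ->
  pair_count h w b c p q = (\sum_(k < q.+1) core_count h w b c p (q - k) * 'C(h - b * p, k))%N.
Proof.
move=> bp; under [RHS]eq_bigr do rewrite big_distrl /=.
rewrite exchange_big /=; apply: eq_bigr => S2 _.
have [/andP[S2V /eqP S2p]|H] :=
  boolP ((S2 \subset ~: horiz_set M h w) && (#|S2| == p)); last first.
  have Z S1 q' : path_pair h w b c p q' S1 S2 = false.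
    by apply/negP => /and5P[_ S2V _ S2p _]; rewrite S2V S2p in H.
  rewrite big1 => [|S1 _]; last by rewrite Z.
  by rewrite big1 // => k _; rewrite big1 // => S1 _; rewrite Z.
have cs := subset_leq_card (shadow_sub_horiz h w b S2).
have := card_free_part (P := fun S1 => compatible h w b c S1 S2) q (shadow_sub_horiz h w b S2).
move=> /(_ (fun A AH => compatible_shadow h_gt0 w_gt0 NE b c AH S2V)).
rewrite (card_horiz_set h_gt0 w_gt0 NE) (card_shadow h_gt0 w_gt0 NE) ?S2p // => E.
transitivity #|[set A : {set 'I_N} |
    [&& A \subset horiz_set M h w, #|A| == q & compatible h w b c A S2]]|.
  rewrite -sum1_card [RHS]big_mkcond /=; apply: eq_bigr => S1 _.
  by rewrite inE /path_pair S2V S2p eqxx /=; case: (_ && _).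
rewrite E; apply: eq_bigr => k _; congr (_ * _)%N.
rewrite -sum1_card [LHS]big_mkcond /=; apply: eq_bigr => S1 _.
rewrite inE /path_pair S2V S2p eqxx /= [in RHS]andbC.
case: (boolP (S1 \subset shadow h w b S2)) => //= sh.
by rewrite (subset_trans sh (shadow_sub_horiz _ _ _ _)) /=; case: (_ && _).
Qed.

Lemma pair_count00 : pair_count h w b c 0 0 = 1%N.
Proof.
rewrite /pair_count (bigD1 set0) //= (bigD1 set0) //= {1}/path_pair !sub0set cards0 /=.
have -> : compatible h w b c (set0 : {set 'I_N}) set0.
  by apply/(compatibleP NE) => u n _; rewrite /conflict inE.
rewrite big1 => [|S1 S10]; last by rewrite /path_pair cards_eq0 (negbTE S10) !andbF.
rewrite big1 // => S2 S20; rewrite big1 // => S1 _.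
by rewrite /path_pair !cards_eq0 (negbTE S20) !andbF.
Qed.

End CompatiblePairs.

Lemma pair_count_rev M h w b c (h_gt0 : (0 < h)%N) (w_gt0 : (0 < w)%N)
    (NE : M.+1 = (h + w)%N) p q :
  pair_count M w h c b q p = pair_count M h w b c p q.
Proof.
have rH h' w' : (0 < h')%N -> (0 < w')%N -> M.+1 = (h' + w')%N ->
    rev_set (horiz_set M w' h') = ~: horiz_set M h' w'.
  move=> h0 w0 E; apply/setP => i; rewrite inE in_setC.
  have -> : rev_ord i = pos M (- 1 - i%:Z) by rewrite pos_rev pos_ord.
  by rewrite -{2}[i]pos_ord !mem_horiz_set // 1?addnC // horiz_rev.
rewrite /pair_count exchange_big /= (reindex_inj (inv_inj (@rev_setK M))) /=.
apply: eq_bigr => S2 _; rewrite (reindex_inj (inv_inj (@rev_setK M))) /=.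
apply: eq_bigr => S1 _; congr nat_of_bool.
rewrite /path_pair !card_rev_set (compatible_rev b c h_gt0 w_gt0 NE) !rev_set_sub.
rewrite rH // -(rH w h) // 1?addnC // rev_setK.
by rewrite andbCA; congr [&& _, _ & _]; rewrite andbCA.
Qed.

(** * Row and column quotients, and the slope rule *)

Definition posn (a : int) : nat := if a is Posz n then n else 0%N.

Lemma posn_part a : posz_part a = (posn a)%:Z.
Proof. by case: a. Qed.

Lemma posnB (m n : nat) : posn (m%:Z - n%:Z) = (m - n)%N.
Proof. case E: (m%:Z - n%:Z) => [k|k] /=; lia. Qed.

Lemma posn_le0 a : a <= 0 -> posn a = 0%N.
Proof. by case: a => //= n; lia. Qed.

Lemma posn_split (a : int) : a = (posn a)%:Z - (posn (- a))%:Z.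
Proof. by case: a => [[|n]|n] //=; lia. Qed.

(** The convention on binomial coefficients with a negative upper argument is
    what replaces the exponent z by its positive part. *)
Lemma binz_posn (z : int) k : (0 < k)%N -> binz (z + k%:Z - 1) k = 'C((posn z + k).-1, k)%:Z.
Proof.
rewrite /binz; case: z => n k0 /=.
  by rewrite (_ : n%:Z + k%:Z - 1 = (n + k).-1%:Z) //=; lia.
rewrite add0n [in RHS]bin_small ?prednK //; case: ifPn => // H.
rewrite bin_small //; lia.
Qed.

(** The tables d and e: the row and column polynomials of a coefficient array
    divided by (1+t)^[a2-cq]_+ and (1+s)^[a1-bp]_+. *)
Definition row_quo (c : nat) (a2 : int) (co : nat -> nat -> int) (p q : nat) : int :=
  binom_deconv (posn (a2 - (c * q)%N%:Z)) (co^~ q) p.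
Definition col_quo (b : nat) (a1 : int) (co : nat -> nat -> int) (p q : nat) : int :=
  binom_deconv (posn (a1 - (b * p)%N%:Z)) (co p) q.

Lemma sum_binom_deconv (z : int) (u : nat -> int) p :
  \sum_(1 <= k < p.+1) (-1) ^+ k.-1 * u (p - k)%N * binz (z + k%:Z - 1) k =
  u p - binom_deconv (posn z) u p.
Proof.
rewrite binom_deconv_last opprD addrA subrr add0r -sumrN !big_nat; apply: eq_bigr => k /andP[k0 _].
rewrite binz_posn //; case: k k0 => // k _; rewrite exprS mulN1r mulNr mulNrn opprK.
by rewrite pmulrn -mulrzr intz.
Qed.

Lemma greedy_recurrenceE b c a1 a2 co : greedy_recurrence b c a1 a2 co <->
  forall p q, (p, q) <> (0, 0)%N -> Num.min (row_quo c a2 co p q) (col_quo b a1 co p q) = 0.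
Proof.
have E p q : co p q = Num.max
      (\sum_(1 <= k < p.+1) (-1) ^+ k.-1 * co (p - k)%N q *
         binz (a2 - (c * q)%:Z + k%:Z - 1) k)
      (\sum_(1 <= k < q.+1) (-1) ^+ k.-1 * co p (q - k)%N *
         binz (a1 - (b * p)%:Z + k%:Z - 1) k) <->
    Num.min (row_quo c a2 co p q) (col_quo b a1 co p q) = 0.
  rewrite (sum_binom_deconv _ (co^~ q)) (sum_binom_deconv _ (co p)).
  rewrite -/(row_quo c a2 co p q) -/(col_quo b a1 co p q).
  by split; lia.
by split=> H p q /H /E.
Qed.

Section SlopeRule.
Variables b c : nat.

(** Off the origin, d lives strictly on one side of the line a1 c q = a2 b p and
    e strictly on the other. *)
Definition slope_rule (a1 a2 : int) (co : nat -> nat -> int) : Prop :=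
  [/\ co 0%N 0%N = 1,
     forall p q, row_quo c a2 co p q != 0 ->
       (p == 0%N) && (q == 0%N) \/ a2 * (b * p)%N%:Z < a1 * (c * q)%N%:Z
   & forall p q, col_quo b a1 co p q != 0 ->
       (p == 0%N) && (q == 0%N) \/ a1 * (c * q)%N%:Z < a2 * (b * p)%N%:Z].

(** At each point other than the origin one of the two quotients vanishes, and
    which one is decided by the point alone. *)
Lemma slope_rule_uniq a1 a2 co co' :
  slope_rule a1 a2 co -> slope_rule a1 a2 co' -> co = co'.
Proof.
move=> [co0 R1 R2] [co0' R1' R2'].
suff H n p q : (p + q < n)%N -> co p q = co' p q.
  by apply: funext => p; apply: funext => q; apply: (H (p + q).+1).
elim: n p q => // n IH p q pq.
have [/andP[/eqP -> /eqP ->]|pq0] := boolP ((p == 0%N) && (q == 0%N)); first by rewrite co0.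
have [lt|ge] := ltrP (a1 * (c * q)%N%:Z) (a2 * (b * p)%N%:Z).
  have Z co1 : (row_quo c a2 co1 p q != 0 ->
        (p == 0%N) && (q == 0%N) \/ a2 * (b * p)%N%:Z < a1 * (c * q)%N%:Z) ->
      row_quo c a2 co1 p q = 0.
    move=> H; apply/eqP/negP => /negP /H [H1|]; first by rewrite H1 in pq0.
    by rewrite ltNge (ltW lt).
  apply: (binom_deconv_eq_last _ (Z _ (R1 _ _)) (Z _ (R1' _ _))) => i ip.
  by apply: IH; lia.
have Z co1 : (col_quo b a1 co1 p q != 0 ->
      (p == 0%N) && (q == 0%N) \/ a1 * (c * q)%N%:Z < a2 * (b * p)%N%:Z) ->
    col_quo b a1 co1 p q = 0.
  move=> H; apply/eqP/negP => /negP /H [H1|]; first by rewrite H1 in pq0.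
  by rewrite ltNge ge.
apply: (binom_deconv_eq_last _ (Z _ (R2 _ _)) (Z _ (R2' _ _))) => i ip.
by apply: IH; lia.
Qed.

(** The corner condition excludes the points where neither quotient involves a
    division; there d = e = c, and c must vanish. *)
Record slope_greedy (a1 a2 : int) (co : nat -> nat -> int) : Prop := SlopeGreedy {
  sg_rule : slope_rule a1 a2 co;
  sg_row_ge0 : forall p q, 0 <= row_quo c a2 co p q;
  sg_col_ge0 : forall p q, 0 <= col_quo b a1 co p q;
  sg_top : forall p q, a1 < q%:Z -> co p q = 0;
  sg_corner : forall p q, a1 < (b * p)%N%:Z -> a2 < (c * q)%N%:Z -> co p q = 0 }.

Lemma slope_greedy_recurrence a1 a2 co : slope_greedy a1 a2 co -> greedy_recurrence b c a1 a2 co.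
Proof.
move=> [[_ R1 R2] D0 E0 _ _]; apply/greedy_recurrenceE => p q pq.
have pq0 : (p == 0%N) && (q == 0%N) = false.
  by apply/negP => /andP[/eqP p0 /eqP q0]; apply: pq; rewrite p0 q0.
have := R1 p q; have := R2 p q; have := D0 p q; have := E0 p q; rewrite pq0.
set d := row_quo _ _ _ _ _; set e := col_quo _ _ _ _ _ => e0 d0.
case: (eqVneq e 0) => [->|_]; first by move=> _ _; lia.
case: (eqVneq d 0) => [->|_]; first by move=> _ _; lia.
move=> /(_ isT)[//|e1] /(_ isT)[//|d1].
by move: (lt_trans e1 d1); rewrite ltxx.
Qed.

End SlopeRule.

Section Existence.

(** Beyond both h and w the coefficient is set to 0 rather than to the number of
    pairs: the recurrence requires it there, and no row with c q <= w nor column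
    with b p <= h contains such a point. *)
Definition path_coeff (h w b c p q : nat) : int :=
  if (h < b * p)%N && (w < c * q)%N then 0
  else (pair_count (h + w).-1 h w b c p q)%:Z.

Variables (h w : nat) (h_gt0 : (0 < h)%N) (w_gt0 : (0 < w)%N).
Let NE : (h + w).-1.+1 = (h + w)%N. Proof. by rewrite prednK // addn_gt0 h_gt0. Qed.

Lemma path_coeff_swap b c p q : path_coeff w h c b q p = path_coeff h w b c p q.
Proof. by rewrite /path_coeff andbC [(w + h)%N]addnC (pair_count_rev _ _ h_gt0 w_gt0 NE). Qed.

Lemma path_col b c p q : col_quo b h%:Z (path_coeff h w b c) p q =
  if (b * p <= h)%N then (core_count (h + w).-1 h w b c p q)%:Z else path_coeff h w b c p q.
Proof.
rewrite /col_quo posnB; case: leqP => bp; last first.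
  by rewrite (_ : h - b * p = 0)%N ?binom_deconv0 //; lia.
pose core q := (core_count (h + w).-1 h w b c p q)%:Z.
transitivity (binom_deconv (h - b * p) (binom_conv (h - b * p) core) q).
  2: by rewrite binom_convK.
congr (binom_deconv _ _ q); apply: funext => {}q.
rewrite /path_coeff ltnNge bp /= binom_convE (pair_count_core h_gt0 w_gt0 NE) //.
rewrite -natz natr_sum; apply: eq_bigr => k _.
by rewrite natz PoszM -mulr_natr natz.
Qed.

Lemma path_col_ge0 b c p q : 0 <= col_quo b h%:Z (path_coeff h w b c) p q.
Proof. by rewrite path_col /path_coeff; case: ifP => // _; case: ifP. Qed.

Lemma path_col_slope b c p q : (0 < b)%N -> col_quo b h%:Z (path_coeff h w b c) p q != 0 ->
  (p == 0%N) && (q == 0%N) \/ h%:Z * (c * q)%N%:Z < w%:Z * (b * p)%N%:Z.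
Proof.
move=> b0; rewrite path_col; case: leqP => bp H.
  have [||lt] := core_slope h_gt0 w_gt0 NE b0 bp (c := c) (q := q); [by move: H; lia | by left |].
  by right; lia.
right; move: H; rewrite /path_coeff bp /=; case: ltnP => //= cq _.
by nia.
Qed.

End Existence.

(** The rows for (h, w) are the columns for (w, h), by reversal of the path. *)
Lemma path_row h w (h_gt0 : (0 < h)%N) (w_gt0 : (0 < w)%N) b c p q :
  row_quo c w%:Z (path_coeff h w b c) p q = col_quo c w%:Z (path_coeff w h c b) q p.
Proof.
congr (binom_deconv _ _ _); apply: funext => i; exact/esym/path_coeff_swap.
Qed.

Lemma path_slope_greedy h w b c : (0 < h)%N -> (0 < w)%N -> (0 < b)%N -> (0 < c)%N ->
  slope_greedy b c h%:Z w%:Z (path_coeff h w b c).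
Proof.
move=> h0 w0 b0 c0.
have NE : (h + w).-1.+1 = (h + w)%N by rewrite prednK // addn_gt0 h0.
split.
- split=> [|p q|p q]; last exact: path_col_slope.
    by rewrite /path_coeff muln0 ltn0 /= (pair_count00 NE).
  by rewrite path_row // => /(path_col_slope w0 h0 c0); rewrite andbC.
- by move=> p q; rewrite path_row // path_col_ge0.
- by move=> p q; rewrite path_col_ge0.
- move=> p q; rewrite ltz_nat => hq; rewrite /path_coeff (pair_count_le h0 w0 NE) //.
  by case: ifP.
- by move=> p q; rewrite !ltz_nat /path_coeff => -> ->.
Qed.

Lemma binom_deconv_zero (R : comNzRingType) n p : binom_deconv n (fun=> 0 : R) p = 0.
Proof. by rewrite /binom_deconv big1 // => k _; rewrite mulr0 mul0rn. Qed.

Definition delta0 (q : nat) : int := (q == 0%N)%:Z.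

Lemma binom_conv_delta0 n q : binom_conv n delta0 q = 'C(n, q)%:Z.
Proof.
rewrite binom_convE (bigD1 ord_max) //= subnn /delta0 /= big1 ?addr0 => [|k kq].
  by rewrite pmulrn -mulrzr mul1r intz.
have kq' : (k < q)%N.
  rewrite ltn_neqAle -ltnS ltn_ord andbT.
  by apply: contra kq => /eqP kq; apply/eqP/val_inj.
by rewrite (_ : (q - k == 0)%N = false) ?mul0rn //; lia.
Qed.

(** For a2 <= 0 the greedy element is x_3^h x_2^(-a2), whose expansion is that
    of (1 + s)^h. *)
Lemma binom_slope_greedy (h b c : nat) (a2 : int) :
    (0 < h)%N -> (0 < b)%N -> (0 < c)%N -> a2 <= 0 ->
  slope_greedy b c h%:Z a2 (fun p q => if p == 0%N then 'C(h, q)%:Z else 0).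
Proof.
move=> h0 b0 c0 a20; set co := fun p q => _.
have row p q : row_quo c a2 co p q = co p q.
  by rewrite /row_quo posn_le0 ?binom_deconv0 //; lia.
have col p q : col_quo b h%:Z co p q = ((p == 0%N) && (q == 0%N))%:Z.
  case: p => [|p]; last exact: binom_deconv_zero.
  rewrite /col_quo muln0 subr0 /=.
  transitivity (binom_deconv h (binom_conv h delta0) q); last by rewrite binom_convK.
  congr (binom_deconv _ _ _).
  by apply: funext => i; rewrite binom_conv_delta0.
split.
- split=> [|p q|p q]; first by rewrite /co bin0.
    rewrite row /co; case: p => [|p] /=; last by [].
    move=> _; case: q => [|q]; [by left | right].
    by rewrite muln0 mulr0; nia.
  by rewrite col; case: (_ && _) => // _; left.
- by move=> p q; rewrite row /co; case: ifP.
- by move=> p q; rewrite col.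
- by move=> p q; rewrite ltz_nat /co => hq; case: ifP => // _; rewrite bin_small.
- by move=> p q; rewrite /co; case: p => //=; lia.
Qed.

(** * Carrying the slope rule through the reflection *)

Section Divisibility.

Definition falling (y : rat) (j : nat) : rat := \prod_(i < j) (y - i%:R).

Lemma fallingS y j : falling y j.+1 = falling y j * (y - j%:R).
Proof. by rewrite /falling big_ord_recr. Qed.

Lemma falling_nat (m j : nat) : falling m%:R j = (j`! * 'C(m, j))%:R.
Proof.
elim: j => [|j IH]; first by rewrite /falling big_ord0 bin0.
rewrite fallingS IH factS [(_ * j`!)%N]mulnC -mulnA mul_bin_left.
have [mj|jm] := ltnP m j; first by rewrite bin_small // !muln0 mul0r.
by rewrite -natrB // -natrM -mulnA; congr (_ * _)%:R; rewrite mulnC.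
Qed.

Lemma falling_opp (m j : nat) :
  falling (- m%:R) j = (-1) ^+ j * (j`! * 'C((m + j).-1, j))%:R.
Proof.
elim: j => [|j IH]; first by rewrite /falling big_ord0 bin0 mulr1.
rewrite fallingS IH addnS /= factS [(_ * j`!)%N]mulnC -mulnA -mul_bin_diag exprS.
rewrite !natrM natrD; ring.
Qed.

(** Both signs of z are covered by the expansion of (1 + t)^(-z), whose
    coefficients are polynomials in z.  This uniformity is what turns the passage
    from one row to the reflected row into a differential operator in the other
    variable. *)
Lemma falling_binom_conv (z : int) (u : nat -> int) p :
  (binom_conv (posn (- z)) (binom_deconv (posn z) u) p)%:~R =
  \sum_(j < p.+1) (j`!%:R)^-1 * falling (- z%:~R) j * (u (p - j)%N)%:~R.
Proof.
have fact0 j : (j`!%:R : rat) != 0 by rewrite pnatr_eq0 -lt0n fact_gt0.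
case: z => m.
  rewrite (@posn_le0 (- m%:Z)) ?oppr_le0 //= /binom_deconv rmorph_sum /=; apply: eq_bigr => j _.
  rewrite rmorphMn rmorphM rmorph_sign /= falling_opp natrM -mulr_natr.
  rewrite (mulrCA (j`!%:R)^-1) (mulrA (j`!%:R)^-1) mulVf // mul1r.
  by rewrite mulrAC.
rewrite (_ : posn (- Negz m) = m.+1) // binom_deconv0 binom_convE rmorph_sum /=.
apply: eq_bigr => j _.
rewrite rmorphMn /= NegzE mulrNz opprK -pmulrn falling_nat natrM mulrA mulVf // mul1r.
by rewrite -mulr_natr mulrC.
Qed.

Variables (c : nat) (a2 : int).

(** The operator falling (c T - a2) j for the Euler derivation T = X d/dX, which
    multiplies 'X^q by falling (c q - a2) j. *)
Fixpoint euler (j : nat) (Q : {poly rat}) : {poly rat} :=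
  if j is j'.+1 then
    c%:R *: ('X * (euler j' Q)^`()) - (a2%:~R + j'%:R) *: euler j' Q
  else Q.

Lemma coef_euler j Q q :
  (euler j Q)`_q = falling (- (a2 - (c * q)%N%:Z)%:~R) j * Q`_q.
Proof.
elim: j => [|j IH]; first by rewrite /falling big_ord0 mul1r.
rewrite fallingS /= coefB !coefZ coefXM coef_deriv IH.
have -> : (if q == 0%N then 0 else (euler j Q)`_q.-1.+1 *+ q.-1.+1) = (euler j Q)`_q * q%:R.
  by case: q {IH} => [|q] /=; rewrite ?mulr0 // mulr_natr.
by rewrite IH intrB -!pmulrn natrM; ring.
Qed.

(** Each derivation costs one factor 1 + X. *)
Lemma dvdp_euler j m Q : (1 + 'X) ^+ (m + j) %| Q -> (1 + 'X) ^+ m %| euler j Q.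
Proof.
elim: j m => [|j IH] m; first by rewrite addn0.
rewrite addnS -addSn => /IH /dvdpP[G E] /=.
have D : (1 + 'X) ^+ m %| (euler j Q)^`().
  rewrite E derivM deriv_exp /= mulrnAr; apply: dvdp_add.
    by rewrite exprS mulrA dvdp_mulIr.
  by rewrite -mulr_natr dvdp_mulr // mulrA dvdp_mulIr.
rewrite -!mul_polyC; apply: dvdp_sub; apply: dvdp_mull.
  by apply: dvdp_mull.
by rewrite E exprS mulrA dvdp_mulIr.
Qed.

End Divisibility.

Section Reversal.
Variable R : comNzRingType.

Definition rev_seq (m : nat) (F : {poly R}) (q : nat) : R :=
  if (q <= m)%N then F`_(m - q) else 0.

Lemma rev_seq_binom_conv n m (F : {poly R}) : (size F <= m.+1)%N ->
  rev_seq (n + m) ((1 + 'X) ^+ n * F) = binom_conv n (rev_seq m F).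
Proof.
move=> sF; elim: n => [|n IH]; first by rewrite mul1r.
rewrite /binom_conv iterS -/(binom_conv n _) -IH exprS -mulrA.
have sz : (size ((1 + 'X) ^+ n * F)%R <= (n + m).+1)%N.
  elim: n {IH} => [|n IH]; first by rewrite mul1r.
  rewrite exprS -mulrA mulrDl mul1r; apply: leq_trans (size_polyD _ _) _.
  rewrite geq_max (leq_trans IH) //=; apply: leq_trans (size_polyMleq _ _) _.
  by rewrite size_polyX /= addSn.
set G := _ * F in sz *; apply: funext => q.
rewrite /shift_add /rev_seq mulrDl mul1r coefD coefXM addSn.
case: q => [|q].
  by rewrite subn0 /= addr0 (nth_default _ sz) add0r subn0.
rewrite subSS; have [qm|mq|->] := ltngtP q (n + m)%N.
- rewrite ltnS (ltnW qm) addrC; congr (_ + _).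
  by rewrite (_ : (n + m - q == 0)%N = false); [congr (_`_ _); lia | lia].
- by rewrite ltnS leqNgt mq /= addr0.
- by rewrite ltnSn subnn /= addr0 add0r.
Qed.

End Reversal.

Definition of_rows (c : nat) (a2 : int) (d : nat -> nat -> int) (p q : nat) : int :=
  binom_conv (posn (a2 - (c * q)%N%:Z)) (d^~ q) p.

Definition flip_rows (h : nat) (d : nat -> nat -> int) (p q : nat) : int :=
  if (q <= h)%N then d p (h - q)%N else 0.

Lemma row_quoK c a2 co : of_rows c a2 (row_quo c a2 co) = co.
Proof. by apply: funext => p; apply: funext => q; rewrite /of_rows binom_deconvK. Qed.

Lemma of_rowsK c a2 d : row_quo c a2 (of_rows c a2 d) = d.
Proof. by apply: funext => p; apply: funext => q; rewrite /row_quo binom_convK. Qed.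

Section Reflection.
Variables (b c h : nat) (a2 : int) (co : nat -> nat -> int).
Hypotheses (b_gt0 : (0 < b)%N) (c_gt0 : (0 < c)%N) (h_gt0 : (0 < h)%N).
Let a2' : int := c%:Z * h%:Z - a2.
Hypothesis a2'_gt0 : 0 < a2'.
Hypothesis sg : slope_greedy b c h%:Z a2 co.

Let d := row_quo c a2 co.
Let d' := flip_rows h d.
Let co' := of_rows c a2' d'.

Lemma col_quo0 q : col_quo b h%:Z co 0 q = (q == 0%N)%:Z.
Proof.
have [[co0 _ R2] _ _ _ _] := sg.
case: q => [|q] /=; first by rewrite /col_quo binom_deconv_head.
apply/eqP/negP => /negP /R2 []//=; rewrite muln0 mulr0; lia.
Qed.

Lemma co_col0 q : co 0 q = 'C(h, q)%:Z.
Proof.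
have := binom_deconvK (posn (h%:Z - (b * 0)%N%:Z)) (co 0) => <-.
have -> : binom_deconv (posn (h%:Z - (b * 0)%N%:Z)) (co 0) = delta0.
  by apply: funext => i; apply: col_quo0.
by rewrite muln0 subr0 binom_conv_delta0.
Qed.

Lemma row_le p q : d p q <= co p q.
Proof.
rewrite -[in X in _ <= X](row_quoK c a2 co).
by apply: binom_conv_ge => i; apply: (sg_row_ge0 sg).
Qed.

Lemma row_neq0 p q : d p q != 0 -> co p q != 0.
Proof. by move: (row_le p q) (sg_row_ge0 sg p q); rewrite -/d; lia. Qed.

(** Beyond the column h / b, the slope rule would place a nonzero entry of d in a
    row where d = c, and there c vanishes by the corner condition. *)
Lemma row_width p q : d p q != 0 -> (b * p <= h)%N.
Proof.
move=> dpq; rewrite leqNgt; apply/negP => hbp.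
have [[_ R1 _] _ _ _ corner] := sg.
have [/andP[/eqP p0 _]|lt] := R1 p q dpq; first by rewrite p0 muln0 in hbp.
have cq : a2 < (c * q)%N%:Z.
  rewrite ltNge; apply/negP => le; move: lt; apply/negP; rewrite -leNgt.
  by nia.
by have := row_neq0 dpq; rewrite corner ?eqxx //; lia.
Qed.

Lemma reflected_row : row_quo c a2' co' = d'. Proof. exact: of_rowsK. Qed.

Lemma reflected_neq0 p q : co' p q != 0 -> (q <= h)%N /\
  exists j : nat, [/\ (j <= p)%N, (j <= posn (a2' - (c * q)%N%:Z))%N & d (p - j) (h - q) != 0].
Proof.
move=> /binom_conv_supp[j /andP[j1 j2]]; rewrite /d' /flip_rows; case: ifP => // qh dj.
by split=> //; exists j.
Qed.

(** A nonzero entry of d forces one of c, which lies at most h - bp above a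
    nonzero entry of e in the same column; the slope condition on e then bounds
    its height. *)
Lemma flip_row_rule p q : d' p q != 0 ->
  (p == 0%N) && (q == 0%N) \/ a2' * (b * p)%N%:Z < h%:Z * (c * q)%N%:Z.
Proof.
rewrite /d' /flip_rows; case: ifP => // qh dpq.
case: (posnP p) => [->|p0].
  case: q qh {dpq} => [|q] _; [by left | right].
  by rewrite muln0 mulr0; nia.
right; have bp := row_width dpq.
have := row_neq0 dpq; rewrite -(binom_deconvK (posn (h%:Z - (b * p)%N%:Z)) (co p)).
move=> /binom_conv_supp[k /andP[k1 k2]].
rewrite -/(col_quo b h%:Z co p (h - q - k)).
have [[_ _ R2] _ _ _ _] := sg.
move=> /R2[|]; first by rewrite (gtn_eqF p0).
by move: k1; rewrite posnB /a2'; nia.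
Qed.

(** The reflected columns do not reach the height that the degree of x_1^(-a1)
    would allow; this is the bound on the degree of the column polynomial that
    [flip_col_rule] combines with its divisibility. *)
Lemma reflected_high p q : (0 < p)%N -> (b * p < h)%N -> co' p q != 0 ->
  a2 * (b * p)%N%:Z < h%:Z * (c * (h - q))%N%:Z.
Proof.
move=> p0 bp /reflected_neq0[qh [j [jp jm dj]]].
have [[_ R1 _] _ _ _ _] := sg.
case: j jp jm dj => [|j] jp jm dj.
  by rewrite subn0 in dj; have [/andP[/eqP E]|//] := R1 _ _ dj; lia.
have cq : a2 < (c * (h - q))%N%:Z.
  move: jm; case: (lerP (a2' - (c * q)%N%:Z) 0) => [/posn_le0 -> //|].
  by rewrite /a2'; nia.
by case: (lerP 0 a2) => a20; nia.
Qed.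

(** In the columns with b p >= h there is no division, and the condition on the
    column quotients bears on the coefficients themselves. *)
Lemma reflected_wide p q : (h <= b * p)%N -> co' p q != 0 ->
  h%:Z * (c * q)%N%:Z < a2' * (b * p)%N%:Z.
Proof.
move=> bp /reflected_neq0[qh [j [jp jm dj]]].
case: (ltrP (c * q)%N%:Z a2') => cq; first by nia.
move: jm; rewrite posn_le0 ?subr_le0 // leqn0 => /eqP j0.
rewrite j0 subn0 in dj.
have bph : (b * p)%N = h by apply/eqP; rewrite eqn_leq bp (row_width dj).
have [[_ R1 _] _ _ _ _] := sg.
have [/andP[/eqP p0 _]|lt] := R1 _ _ dj; first by rewrite p0 muln0 in bph; lia.
by move: lt cq; rewrite bph /a2'; nia.
Qed.

Let Q (p : nat) : {poly rat} := \poly_(q < h.+1) (co p q)%:~R.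

Lemma coef_col p q : (Q p)`_q = (co p q)%:~R.
Proof.
rewrite coef_poly; case: ltnP => // hq.
by rewrite (sg_top sg) // ltz_nat.
Qed.

(** The slope rule makes e finitely supported in each column, so that the power
    series quotient is a polynomial. *)
Lemma dvdp_col p : (1 + 'X) ^+ (h - b * p) %| Q p.
Proof.
pose B := (posn a2 * (b * p)).+1.
pose E : {poly rat} := \poly_(q < B) (col_quo b h%:Z co p q)%:~R.
have [[_ _ R2] _ _ _ _] := sg.
have coefE q : E`_q = (col_quo b h%:Z co p q)%:~R.
  rewrite coef_poly; case: ltnP => // Bq; apply/eqP; rewrite eq_sym intr_eq0.
  apply/negP => /negP /R2 [/andP[_ /eqP q0]|]; first by rewrite q0 /B in Bq.
  have a2le : a2 * (b * p)%N%:Z <= (posn a2 * (b * p))%N%:Z.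
    apply: (@le_trans _ _ ((posn a2)%:Z * (b * p)%N%:Z)); last by rewrite -PoszM.
    by apply: ler_wpM2r => //; case: (a2).
  have qle : q%:Z <= h%:Z * (c * q)%N%:Z by nia.
  by move: Bq; rewrite /B; lia.
apply/dvdpP; exists E; apply/polyP => q.
rewrite mulrC -[RHS](congr1 (@^~ q) (binom_conv_coef _ _)) coef_col -posnB.
rewrite -[in LHS](binom_deconvK (posn (h%:Z - (b * p)%N%:Z)) (co p)).
rewrite (binom_conv_morph intr); congr (binom_conv _ _ q).
by apply: funext => i; rewrite coefE.
Qed.

(* The reflected column p, read from the top. *)
Let Rcol (p : nat) : {poly rat} :=
  \sum_(j < p.+1) (j`!%:R)^-1 *: euler c a2 j (Q (p - j)).

Lemma coef_reflected_col p q : (Rcol p)`_q = if (q <= h)%N then (co' p (h - q))%:~R else 0.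
Proof.
rewrite /Rcol coef_sum; case: leqP => qh.
  rewrite /co' /of_rows.
  have -> : a2' - (c * (h - q))%N%:Z = - (a2 - (c * q)%N%:Z) by rewrite /a2'; nia.
  have -> : d'^~ (h - q)%N = binom_deconv (posn (a2 - (c * q)%N%:Z)) (co^~ q).
    by apply: funext => i; rewrite /d' /flip_rows leq_subr subKn.
  rewrite falling_binom_conv; apply: eq_bigr => j _.
  by rewrite coefZ coef_euler coef_col mulrA.
apply: big1 => j _; rewrite coefZ coef_euler coef_col.
by rewrite (sg_top sg) ?ltz_nat // mulr0 mulr0.
Qed.

(** The operator of order j is applied to the column p - j, which has b j >= j
    more factors 1 + X than the column p. *)
Lemma dvdp_reflected_col p : (1 + 'X) ^+ (h - b * p) %| Rcol p.
Proof.
apply: (big_ind (fun R => (1 + 'X) ^+ (h - b * p) %| R)) => [||j _].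
- exact: dvdp0.
- by move=> ? ?; apply: dvdp_add.
have [hp|ph] := leqP h (b * p)%N.
  by rewrite (eqP (_ : h - b * p == 0)%N) ?dvd1p // subn_eq0.
rewrite -mul_polyC; apply: dvdp_mull; apply: dvdp_euler.
apply: dvdp_trans (dvdp_col (p - j)); apply: dvdp_exp2l.
by have := ltn_ord j; nia.
Qed.

(** For b p < h the reflected column is (1+s)^(h-bp) times the reverse of a
    polynomial F of degree at most b p, and the low coefficients of F vanish with
    those of the column read from the top, by [reflected_high]. *)
Lemma flip_col_rule p q : col_quo b h%:Z co' p q != 0 ->
  (p == 0%N) && (q == 0%N) \/ h%:Z * (c * q)%N%:Z < a2' * (b * p)%N%:Z.
Proof.
rewrite /col_quo posnB; have [hp|ph] := leqP h (b * p)%N.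
  rewrite (eqP (_ : h - b * p == 0)%N) ?subn_eq0 // binom_deconv0 => /(reflected_wide hp).
  by right.
have /dvdpP[F RF] := dvdp_reflected_col p.
set n := (h - b * p)%N in RF *.
have co'E : (fun q => (co' p q)%:~R) = rev_seq h (Rcol p).
  apply: funext => i; rewrite /rev_seq coef_reflected_col leq_subr.
  case: leqP => hi; first by rewrite subKn.
  by rewrite /co' /of_rows /d' /flip_rows; apply/eqP; rewrite intr_eq0; apply/eqP;
    rewrite binom_convE big1 // => k _; rewrite leqNgt hi mul0rn.
have sF : (size F <= (b * p).+1)%N.
  have [->|F0] := eqVneq F 0; first by rewrite size_poly0.
  have : (size (Rcol p) <= h.+1)%N.
    apply/leq_sizeP => i hi; rewrite coef_reflected_col leqNgt hi //.
  rewrite RF (_ : 1 + 'X = 'X - (-1)%:P); last by rewrite polyCN opprK addrC.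
  rewrite size_Mmonic ?monic_exp ?monicXsubC // size_exp_XsubC addnS /= /n.
  by move: (size F) => s; clear -ph; lia.
have hE : h = (n + b * p)%N by rewrite subnK // ltnW.
rewrite -(intr_eq0 rat) (binom_deconv_morph intr).
have -> : intr \o co' p = binom_conv n (rev_seq (b * p) F).
  by rewrite -rev_seq_binom_conv // -hE [_ * F]mulrC -RF -co'E.
rewrite binom_convK /rev_seq; case: leqP => // qbp F0.
case: (posnP p) => p0; first by left; move: qbp; rewrite p0 muln0; lia.
right; rewrite ltNge; apply/negP => low; case/negP: F0; apply/eqP.
rewrite -(binom_deconv_coef n) mulrC -RF.
rewrite (@binom_deconv_ext _ _ _ (fun=> 0)); first exact: binom_deconv_zero.
move=> i ib; rewrite coef_reflected_col; case: leqP => // ih; apply/eqP; rewrite intr_eq0.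
apply/negP => /negP /(reflected_high p0 ph); rewrite subKn //.
by apply/negP; rewrite -leNgt; move: low; rewrite /a2'; nia.
Qed.

(** The value at the origin is c(0, h), the top coefficient of (1 + s)^h. *)
Theorem flip_slope_rule : slope_rule b c h%:Z a2' co'.
Proof.
split; [|move=> p q; rewrite reflected_row; exact: flip_row_rule | exact: flip_col_rule].
rewrite /co' /of_rows binom_convE big_ord1 bin0 mulr1n /d' /flip_rows /= subn0 /d.
by rewrite /row_quo binom_deconv_head co_col0 subn0 binn.
Qed.

End Reflection.

(** * Reflected tables of row quotients are greedy *)

Lemma slope_greedy_exists b c h (a2 : int) : (0 < b)%N -> (0 < c)%N -> (0 < h)%N ->
  exists co, slope_greedy b c h%:Z a2 co.
Proof.
move=> b0 c0 h0; case: (lerP a2 0) => a20.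
  by eexists; apply: binom_slope_greedy.
case: a2 a20 => // w w0; exists (path_coeff h w b c).
exact: path_slope_greedy.
Qed.

Record greedy_rows b c (a1 a2 : int) (d : nat -> nat -> int) : Prop := GreedyRows {
  gr_ge0 : forall p q, 0 <= d p q;
  gr_top : forall p q, (posn a1 < q)%N -> d p q = 0;
  gr_one : of_rows c a2 d 0 0 = 1;
  gr_rec : greedy_recurrence b c a1 a2 (of_rows c a2 d) }.

Lemma flip_rowsK h d : (forall p q, (h < q)%N -> d p q = 0) ->
  flip_rows h (flip_rows h d) = d.
Proof.
move=> dh; apply: funext => p; apply: funext => q; rewrite /flip_rows leq_subr.
by case: leqP => hq; rewrite ?subKn // dh.
Qed.

Lemma flip_rows_top h d p q : (h < q)%N -> flip_rows h d p q = 0.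
Proof. by move=> hq; rewrite /flip_rows leqNgt hq. Qed.

Definition delta00 (p q : nat) : int := ((p == 0%N) && (q == 0%N))%:Z.

(** For a1 <= 0 all the columns are free of division and d is concentrated at
    the origin, for every a2.  For a1 = h > 0 the reflected array obeys the slope
    rule as soon as c h - a2 > 0, so that it agrees with the array which
    [slope_greedy_exists] provides there.  When c h - a2 <= 0, this applies to
    c h - a2, whose reflection a2 is positive. *)
Theorem greedy_rows_reflect b c (a1 a2 : int) : (0 < b)%N -> (0 < c)%N ->
  exists2 d, greedy_rows b c a1 a2 d &
    greedy_rows b c a1 (c%:Z * posz_part a1 - a2) (flip_rows (posn a1) d).
Proof.
move=> b0 c0; rewrite posn_part.
have [a10|h0] := posnP (posn a1).
  have dE : flip_rows (posn a1) delta00 = delta00.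
    apply: funext => p; apply: funext => q; rewrite a10 /flip_rows /delta00.
    by case: q => [|q] /=; [|rewrite andbF].
  have G a : greedy_rows b c a1 a delta00.
    split=> [p q|p q|//|].
    - by rewrite /delta00.
    - by rewrite a10 /delta00 => /gtn_eqF ->; rewrite andbF.
    - by rewrite /of_rows binom_convE big_ord1 bin0.
    apply/greedy_recurrenceE => p q pq; rewrite of_rowsK /delta00.
    rewrite (_ : (p == 0%N) && (q == 0%N) = false); last first.
      by apply/negP => /andP[/eqP p0 /eqP q0]; apply: pq; rewrite p0 q0.
    apply/min_idPl; rewrite /col_quo posn_le0; last by case: (a1) a10 => [[]|]//=; lia.
    by rewrite binom_deconv0; apply: binom_conv_ge0 => i; rewrite /delta00.
  by exists delta00; rewrite ?dE; apply: G.
have {a1 h0} [h h0 ->] : exists2 h, (0 < h)%N & a1 = h%:Z by case: a1 h0 => // h h0; exists h.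
rewrite /=.
have main a : 0 < c%:Z * h%:Z - a -> exists2 d, greedy_rows b c h%:Z a d &
    greedy_rows b c h%:Z (c%:Z * h%:Z - a) (flip_rows h d).
  move=> a'0; have [co sg] := slope_greedy_exists a b0 c0 h0.
  have [co' sg'] := slope_greedy_exists (c%:Z * h%:Z - a) b0 c0 h0.
  have E := slope_rule_uniq (flip_slope_rule b0 c0 h0 a'0 sg) (sg_rule sg').
  exists (row_quo c a co).
    split=> [p q|p q /= hq||]; rewrite ?row_quoK.
    - exact: (sg_row_ge0 sg).
    - rewrite /row_quo (@binom_deconv_ext _ _ _ (fun=> 0)) ?binom_deconv_zero // => i _.
      by rewrite (sg_top sg).
    - by case: (sg_rule sg).
    - exact: slope_greedy_recurrence.
  split=> [p q|p q /= hq||].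
  - by rewrite /flip_rows; case: ifP => // _; apply: (sg_row_ge0 sg).
  - exact: flip_rows_top.
  - by rewrite E; case: (sg_rule sg').
  - by rewrite E; apply: slope_greedy_recurrence.
case: (ltrP 0 (c%:Z * h%:Z - a2)) => a'; first exact: main.
have [|d G G'] := main (c%:Z * h%:Z - a2).
  by rewrite subKr; nia.
exists (flip_rows h d); first by rewrite subKr in G'.
by rewrite flip_rowsK // => p q; apply: (gr_top G).
Qed.

(** * Expansions in the field of fractions *)

Lemma greedy_recurrence_swap b c a1 a2 co : greedy_recurrence b c a1 a2 co ->
  greedy_recurrence c b a2 a1 (fun p q => co q p).
Proof.
move=> H p q pq; rewrite (H q p); first by rewrite maxC.
by move=> [q0 p0]; apply: pq; rewrite q0 p0.
Qed.

Section Expansion.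
Variable F : fieldType.
Implicit Types (u v x : F) (b c : nat).

(** Pointed expansions in an arbitrary ordered pair of elements, so that the two
    initial variables can be exchanged. *)
Definition expansion u v b c (a1 a2 : int) (co : nat -> nat -> int) x : Prop :=
  co 0%N 0%N = 1 /\
  exists2 N : nat,
    (forall p q, co p q != 0 -> (p < N)%N /\ (q < N)%N) &
    x = u ^ (- a1) * v ^ (- a2) *
        \sum_(p < N) \sum_(q < N) (co p q)%:~R * u ^+ (b * p) * v ^+ (c * q).

Lemma expansion_swap u v b c a1 a2 co x : expansion u v b c a1 a2 co x ->
  expansion v u c b a2 a1 (fun p q => co q p) x.
Proof.
move=> [co0 [N supp ->]]; split=> //; exists N => [p q /supp[]//|].
rewrite exchange_big /= [u ^ _ * _]mulrC; congr (_ * _).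
by apply: eq_bigr => p _; apply: eq_bigr => q _; rewrite mulrAC.
Qed.

(** The element with table of row quotients d, in a form that makes its image
    under v |-> (1 + u^b) / v visible. *)
Definition row_form u v b c (a1 a2 : int) (K : nat) (d : nat -> nat -> int) : F :=
  u ^ (- a1) * v ^ (- a2) *
  \sum_(q < (posn a1).+1) v ^+ (c * q) * (1 + u ^+ b) ^+ posn (a2 - (c * q)%N%:Z) *
    \sum_(p < K) (d p q)%:~R * (u ^+ b) ^+ p.

Lemma row_form_expansion u v b c a1 a2 K d :
    (forall p q, (K <= p)%N -> d p q = 0) ->
    (forall p q, (posn a1 < q)%N -> d p q = 0) -> of_rows c a2 d 0 0 = 1 ->
  expansion u v b c a1 a2 (of_rows c a2 d) (row_form u v b c a1 a2 K d).
Proof.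
move=> dK dA d0; split=> //; pose N := (K + posn a2 + posn a1).+1.
have pos_le q : (posn (a2 - (c * q)%N%:Z) <= posn a2)%N.
  case: a2 d0 @N => n _ N /=; last by rewrite posn_le0 //; lia.
  by rewrite posnB leq_subr.
have supp p q : of_rows c a2 d p q != 0 -> (p < N)%N /\ (q <= posn a1)%N.
  move=> /binom_conv_supp[k /andP[k1 k2] dk]; split.
    have : (p - k < K)%N by rewrite ltnNge; apply: contra dk => /dK ->.
    by have := pos_le q; rewrite /N; lia.
  by rewrite leqNgt; apply: contra dk => /dA ->.
exists N => [p q /supp[pN qA]|]; first by split; rewrite // /N; lia.
congr (_ * _); rewrite exchange_big /=.
pose G q : F := \sum_(p < N) (of_rows c a2 d p q)%:~R * u ^+ (b * p) * v ^+ (c * q).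
rewrite -[RHS]/(\sum_(q < N) G q).
have AN : ((posn a1).+1 <= N)%N by rewrite /N; lia.
have -> : \sum_(q < N) G q = \sum_(q < (posn a1).+1) G q.
  rewrite (big_ord_widen N G AN) [RHS]big_mkcond; apply: eq_bigr => q _ /=.
  case: ifPn => // qA; rewrite /G big1 // => p _.
  have [->|/supp[_]] := eqVneq (of_rows c a2 d p q) 0; first by rewrite !mul0r.
  by move: qA; rewrite ltnS => /negbTE ->.
apply: eq_bigr => q _; rewrite /G -mulr_suml -mulrA mulrC; congr (_ * _).
rewrite -(@binom_conv_powersum _ _ (fun p => (d p q)%:~R) K N).
- by apply: eq_bigr => p _; rewrite exprM /of_rows (binom_conv_morph intr).
- by move=> p /dK ->.
- by have := pos_le q; rewrite /N; lia.
Qed.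

(** The exponent of v changes sign, and with it the exponent c q - a2 of 1 + u^b
    is added to [a2 - cq]_+, which leaves [cq - a2]_+. *)
Lemma row_form_reflect u v b c a1 a2 K d (s : {rmorphism F -> F}) :
    u != 0 -> v != 0 -> s u = u -> s v = (u ^+ b + 1) / v ->
  s (row_form u v b c a1 a2 K d) =
  row_form u v b c a1 (c%:Z * posz_part a1 - a2) K (flip_rows (posn a1) d).
Proof.
move=> u0 v0 su sv.
have w0 : 1 + u ^+ b != 0.
  have : s v != 0 by rewrite fmorph_eq0.
  by rewrite sv mulf_eq0 negb_or addrC => /andP[].
rewrite /row_form posn_part !rmorphM /= !fmorphXz su sv -!mulrA; congr (_ * _).
rewrite rmorph_sum !mulr_sumr [RHS](reindex_inj rev_ord_inj) /=.
apply: eq_bigr => q _; have qA : (q <= posn a1)%N by rewrite -ltnS.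
rewrite subSS !rmorphM !rmorphXn rmorphD rmorph1 rmorphXn /= su sv !mulrA; congr (_ * _).
  rewrite [u ^+ b + 1]addrC; move: (1 + u ^+ b) w0 => W W0; rewrite !exprnP.
  set m := posn (a2 - _); set m' := posn (_ - _).
  set A := posn a1 in qA *.
  have E : (c * q)%N%:Z - a2 + m%:Z = m'%:Z.
    have := posn_split (a2 - (c * q)%N%:Z); rewrite -/m.
    rewrite (_ : - (a2 - (c * q)%N%:Z) = c%:Z * A%:Z - a2 - (c * (A - q))%N%:Z).
      by rewrite -/m'; lia.
    by rewrite mulnBr -subzn ?leq_mul2l ?qA ?orbT // PoszM; ring.
  have E2 : - (c%:Z * A%:Z - a2) + (c * (A - q))%N%:Z = - ((c * q)%N%:Z - a2).
    by rewrite mulnBr -subzn ?leq_mul2l ?qA ?orbT // PoszM; ring.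
  have w1 : W / v != 0 by rewrite mulf_neq0 ?invr_eq0.
  rewrite -!expfzDr // E2 -E [- a2 + _]addrC [in RHS]expfzDr // expfzMl exprz_inv.
  by rewrite mulrAC mulrC.
rewrite rmorph_sum; apply: eq_bigr => p _.
rewrite rmorphM rmorph_int !rmorphXn /= su /flip_rows leq_subr subKn //.
Qed.

(** Given a greedy element, its coefficients are those of the table d by
    uniqueness of the solution of the recurrence; d is finitely supported because
    0 <= d <= c. *)
Lemma expansion_reflect u v b c a1 a2 co x (s : {rmorphism F -> F}) :
    (forall co1 co2 y z, (forall p q, co1 p q = co2 p q) ->
       expansion u v b c a1 a2 co1 y -> expansion u v b c a1 a2 co2 z -> y = z) ->
    (0 < b)%N -> (0 < c)%N ->
    u != 0 -> v != 0 -> s u = u -> s v = (u ^+ b + 1) / v ->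
    expansion u v b c a1 a2 co x -> greedy_recurrence b c a1 a2 co ->
  exists2 co', expansion u v b c a1 (c%:Z * posz_part a1 - a2) co' (s x) &
    greedy_recurrence b c a1 (c%:Z * posz_part a1 - a2) co'.
Proof.
move=> uniq b0 c0 u0 v0 su sv ex rec.
have [d G G'] := greedy_rows_reflect a1 a2 b0 c0.
have coE : forall p q, co p q = of_rows c a2 d p q.
  by apply: greedy_coeffs_uniq rec (gr_rec G); rewrite (gr_one G); case: ex.
have [_ [K supp _]] := ex.
have dK p q : (K <= p)%N -> d p q = 0.
  move=> Kp; have co0 : co p q = 0.
    by apply/eqP/negP => /negP /supp[]; rewrite ltnNge Kp.
  apply/eqP; rewrite eq_le (gr_ge0 G) andbT -co0 coE.
  by apply: binom_conv_ge => i; apply: (gr_ge0 G).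
have E := row_form_expansion u v b dK (gr_top G) (gr_one G).
exists (of_rows c (c%:Z * posz_part a1 - a2) (flip_rows (posn a1) d)); last exact: (gr_rec G').
rewrite (uniq _ _ _ _ coE ex E) (row_form_reflect _ _ _ _ _ u0 v0 su sv).
apply: row_form_expansion; last exact: (gr_one G').
- by move=> p q Kp; rewrite /flip_rows dK // if_same.
- by move=> p q; apply: (gr_top G').
Qed.

End Expansion.

(** * The automorphisms of the cluster algebra *)

Section Automorphisms.
Variables b c : nat.
Local Notation x_ := (clvar b c).
Local Notation A := (clalg b c).

(** The cluster variables generate the algebra. *)
Lemma clalg_morph_eq (R : pzRingType) (f g : {rmorphism A -> R}) :
  (forall m, f (clelt b c m) = g (clelt b c m)) -> forall y, f y = g y.
Proof.
move=> fg y; pose S : {pred ambient} := fun z => `[< exists2 t : A, clalg_val t = z & f t = g t >].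
suff SS : subring_closed S.
  have /in_clalgP/(_ S SS) yS := valP y.
  have xS m : x_ m \in S by apply/asboolP; exists (clelt b c m).
  have /asboolP[t tE ft] := yS xS.
  by have <- : t = y by apply: val_inj.
split=> [|_ _ /asboolP[t <- ft] /asboolP[t' <- ft']|_ _ /asboolP[t <- ft] /asboolP[t' <- ft']];
  apply/asboolP.
- by exists 1; rewrite ?rmorph1.
- by exists (t - t'); rewrite // !rmorphB ft ft'.
- by exists (t * t'); rewrite // !rmorphM ft ft'.
Qed.

Lemma clalg_val_sigma (p : int) (s : {rmorphism ambient -> ambient}) :
  (forall m, s (x_ m) = x_ (2 * p - m)) ->
  forall y : A, clalg_val (sigma b c p y) = s (clalg_val y).
Proof.
move=> sE.
have [v_zmod v_mon] : zmod_morphism (@clalg_val b c) /\ monoid_morphism (@clalg_val b c).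
  by split=> //; split.
pose zm := GRing.isZmodMorphism.Build _ _ (@clalg_val b c) v_zmod.
pose mm := GRing.isMonoidMorphism.Build _ _ (@clalg_val b c) v_mon.
pose i : {rmorphism A -> ambient} := HB.pack (@clalg_val b c) zm mm.
apply: (@clalg_morph_eq _ (i \o sigma b c p) (s \o i)) => m /=.
by rewrite sigma_clelt /= sE.
Qed.

Lemma sigma_comp (p : int) y :
  sigma b c (p + 1) y = sigma b c 2 (sigma b c 1 (sigma b c p y)).
Proof.
apply: (@clalg_morph_eq _ (sigma b c (p + 1))
  (sigma b c 2 \o (sigma b c 1 \o sigma b c p))) => m /=.
by rewrite !sigma_clelt; congr clelt; lia.
Qed.

Hypotheses (b_gt0 : (0 < b)%N) (c_gt0 : (0 < c)%N).

Lemma sigma1_greedy a1 a2 (y : A) : is_greedy a1 a2 y ->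
  is_greedy a1 (c%:Z * posz_part a1 - a2) (sigma b c 1 y).
Proof.
move=> [co ex rec]; have [s sE] := field_reflection b c 1.
rewrite /is_greedy (clalg_val_sigma sE).
have [] := @expansion_reflect _ var1 var2 b c a1 a2 co (clalg_val y) s _ b_gt0 c_gt0 _ _ _ _ ex rec.
- by move=> co1 co2 u v co12; apply: pointed_expansion_uniq.
- exact: (clvar_neq0 b c 1).
- exact: (clvar_neq0 b c 2).
- exact: (sE 1).
- exact: (sE 2).
by move=> co' ex' rec'; exists co'.
Qed.

Lemma sigma2_greedy a1 a2 (y : A) : is_greedy a1 a2 y ->
  is_greedy (b%:Z * posz_part a2 - a1) a2 (sigma b c 2 y).
Proof.
move=> [co ex rec]; have [s sE] := field_reflection b c 2.
rewrite /is_greedy (clalg_val_sigma sE).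
have [] := @expansion_reflect _ var2 var1 c b a2 a1 (fun p q => co q p) (clalg_val y) s
  _ c_gt0 b_gt0 _ _ _ _ (expansion_swap ex) (greedy_recurrence_swap rec).
- move=> co1 co2 u v co12 /expansion_swap e1 /expansion_swap e2.
  exact: (pointed_expansion_uniq _ e1 e2).
- exact: (clvar_neq0 b c 2).
- exact: (clvar_neq0 b c 1).
- exact: (sE 2).
- exact: (sE 1).
move=> co' /expansion_swap ex' /greedy_recurrence_swap rec'.
by exists (fun p q => co' q p).
Qed.

Lemma greedyP a1 a2 :
  is_greedy a1 a2 (greedy b c a1 a2) \/
  greedy b c a1 a2 = 0 /\ forall y : A, ~ is_greedy a1 a2 y.
Proof. by rewrite /greedy; case: xgetP => [y _ gy|gy]; [left | right]. Qed.

(** If no greedy element exists at one of the two points then none exists at the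
    other, and both sides are the default value 0. *)
Lemma greedy_transport (f : {rmorphism A -> A}) (a1 a2 a1' a2' : int) : involutive f ->
    (forall y, is_greedy a1 a2 y -> is_greedy a1' a2' (f y)) ->
    (forall y, is_greedy a1' a2' y -> is_greedy a1 a2 (f y)) ->
  f (greedy b c a1 a2) = greedy b c a1' a2'.
Proof.
move=> fK to fro; case: (greedyP a1 a2) => [/to G|[-> none]].
  by case: (greedyP a1' a2') => [|[_ /(_ _ G)//]]; apply: is_greedy_uniq.
by rewrite rmorph0; case: (greedyP a1' a2') => [/fro/none|[->]].
Qed.

Lemma sigma1E a1 a2 : sigma b c 1 (greedy b c a1 a2) = greedy b c a1 (c%:Z * posz_part a1 - a2).
Proof.
apply: greedy_transport => [|y|y]; [exact: sigmaK | exact: sigma1_greedy |].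
by move/sigma1_greedy; rewrite subKr.
Qed.

Lemma sigma2E a1 a2 : sigma b c 2 (greedy b c a1 a2) = greedy b c (b%:Z * posz_part a2 - a1) a2.
Proof.
apply: greedy_transport => [|y|y]; [exact: sigmaK | exact: sigma2_greedy |].
by move/sigma2_greedy; rewrite subKr.
Qed.

(** Induction on p in both directions, since sigma_(p+1) is the composite of
    sigma_p, sigma_1 and sigma_2, the last two being involutions. *)
Lemma sigma_basis (p : int) y : greedy_basis b c y -> greedy_basis b c (sigma b c p y).
Proof.
pose P (q : int) := forall z, greedy_basis b c z -> greedy_basis b c (sigma b c q z).
have s1 : P 1.
  by move=> z [[a1 a2] _ <-] /=; rewrite sigma1E; exists (a1, c%:Z * posz_part a1 - a2).
have s2 : P 2.
  by move=> z [[a1 a2] _ <-] /=; rewrite sigma2E; exists (b%:Z * posz_part a2 - a1, a2).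
have upS q : P q -> P (q + 1).
  by move=> Pq z gz; rewrite (sigma_comp q z); apply: s2; apply: s1; apply: Pq.
have dnS q : P (q + 1) -> P q.
  move=> Pq z gz; have E := sigma_comp q z.
  rewrite -[X in greedy_basis b c X](sigmaK 1) -[X in sigma b c 1 X](sigmaK 2) -E.
  by apply: s1; apply: s2; apply: Pq.
have up n : P (1 + n%:Z).
  elim: n => [|n IH]; first by rewrite addr0.
  by rewrite (_ : 1 + n.+1%:Z = 1 + n%:Z + 1); [apply: upS | lia].
have dn n : P (1 - n%:Z).
  elim: n => [|n IH]; first by rewrite subr0.
  by apply: dnS; rewrite (_ : 1 - n.+1%:Z + 1 = 1 - n%:Z) //; lia.
have [p1|p1] := lerP 1 p.
  by rewrite (_ : p = 1 + `|p - 1|%N%:Z); [exact: up | lia].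
by rewrite (_ : p = 1 - `|1 - p|%N%:Z); [exact: dn | lia].
Qed.

End Automorphisms.

Local Open Scope classical_set_scope.

Theorem proposition1p8 (b c : nat) (b_gt0 : (0 < b)%N) (c_gt0 : (0 < c)%N) :
  (forall p : int, sigma b c p @` greedy_basis b c = greedy_basis b c) /\
  (forall a1 a2 : int,
     sigma b c 1 (greedy b c a1 a2) = greedy b c a1 (c%:Z * posz_part a1 - a2) /\
     sigma b c 2 (greedy b c a1 a2) = greedy b c (b%:Z * posz_part a2 - a1) a2).
Proof.
split=> [p|a1 a2]; last by rewrite sigma1E ?sigma2E.
apply/seteqP; split=> [_ [y gy <-]|y gy]; first exact: sigma_basis.
by exists (sigma b c p y); [apply: sigma_basis | apply: sigmaK].
Qed.
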